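(* Fix $\varepsilon>0$ and $D>0$. For each $n\ge1$ let $(X_{ij})_{1\le i\le j\le n}$ (depending on $n$) be a centered multivariate Gaussian vector with $\operatorname{Var}(X_{ij})=1$ for all $i\le j$ and $$\sup_{(i,j)\ne(i',j')}\big|\mathbb{E}[X_{ij}X_{i'j'}]\big|=O\Big(\frac{1}{n^{1+\varepsilon}}\Big),$$ the supremum being over pairs with $i\le j$, $i'\le j'$. Let $X_n$ be the symmetric $n\times n$ matrix with entries $X_n(i,j)=X_n(j,i)=X_{ij}$ for $i\le j$. Let $\lambda=\lambda_n$ satisfy $0<\lambda\le D\sqrt n$, put $\mu=\lambda/\sqrt n$ and $$Y_n=X_n+\mu\,\mathbf{1}\mathbf{1}^\top .$$ Then, as $n\to\infty$, $$\sqrt n\Big[\lambda_1(n^{-1/2}Y_n)-\Big(\lambda+\frac1\lambda\Big)\Big]=\frac1n\sum_{i,j}X_{ij}+\frac{\sqrt n}{\lambda}\cdot O_P\Big(n^{-\frac{\min\{\varepsilon,1\}}{2}}\Big)+O_P\Big(\frac{\sqrt n}{\lambda^2}\Big).$$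
   Context: $\lambda_1(A)$ denotes the largest eigenvalue of a real symmetric matrix $A$; $\mathbf{1}\in\mathbb{R}^n$ is the all-ones vector; $\sum_{i,j}X_{ij}=\sum_{i=1}^n\sum_{j=1}^nX_n(i,j)$ is the sum of all entries of $X_n$. $O_P(a_n)$ denotes a random quantity which, divided by $a_n$, is a tight sequence. *)

(* Defs.v *)
(* Written over MathComp and MathComp-Analysis. *)
From HB Require Import structures.
From mathcomp Require Import all_boot all_order all_algebra.
From mathcomp Require Import all_classical all_reals all_analysis.
Import Order.TTheory GRing.Theory Num.Def Num.Theory.
Import numFieldNormedType.Exports.

Set Implicit Arguments.
Unset Strict Implicit.
Unset Printing Implicit Defensive.

Local Open Scope classical_set_scope.
Local Open Scope ring_scope.

(* Index pairs (i, j) with i <= j. *)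
Definition triu (n : nat) := {p : 'I_n * 'I_n | (p.1 <= p.2)%N}.

Lemma triu_pair_subproof (n : nat) (i j : 'I_n) :
  let p := if (i <= j)%N then (i, j) else (j, i) in (p.1 <= p.2)%N.
Proof. by case: ifP => //= /negbT; rewrite -ltnNge => /ltnW. Qed.

Definition triu_pair (n : nat) (i j : 'I_n) : triu n :=
  exist _ (if (i <= j)%N then (i, j) else (j, i)) (triu_pair_subproof i j).

Definition sym_mx (R : realType) (n : nat) (x : triu n -> R) : 'M[R]_n :=
  \matrix_(i, j) x (triu_pair i j).

(* For symmetric A and 0 < n the set of eigenvalues is finite and nonempty, so
   this supremum is a maximum. *)
Definition lambda1 (R : realType) (n : nat) (A : 'M[R]_n) : R :=
  sup [set a | eigenvalue A a].

(* [normal_prob m 0] is the uniform law on [0, 1], not the point mass at m, so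
   the degenerate case has to be separated. *)
Definition gaussian_law (R : realType) (m s : R) : set R -> \bar R :=
  if s == 0 then fun A => \d_m A else fun A => normal_prob m s A.

(* A random vector is Gaussian when all linear combinations of its coordinates
   are univariate Gaussian, possibly degenerate. *)
Definition gaussian_vector (R : realType) (d : measure_display)
    (T : measurableType d) (P : probability T R) (I : finType)
    (X : I -> {RV P >-> R}) : Prop :=
  forall a : I -> R, exists m s : R, forall A : set R, measurable A ->
    P [set w | A (\sum_i a i * X i w)] = gaussian_law m s A.

(* Sequences are indexed by n >= 1; the term n = 0 is ignored. *)
Definition tight (R : realType) (d : nat -> measure_display)
    (T : forall n, measurableType (d n)) (P : forall n, probability (T n) R)
    (Z : forall n, T n -> R) : Prop :=
  forall eta : R, 0 < eta -> exists K : set R, compact K /\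
    forall n, (0 < n)%N -> (P n (Z n @^-1` (~` K)) <= eta%:E)%E.

Definition is_OP (R : realType) (d : nat -> measure_display)
    (T : forall n, measurableType (d n)) (P : forall n, probability (T n) R)
    (Z : forall n, {RV (P n) >-> R}) (a : nat -> R) : Prop :=
  tight P (fun n w => Z n w / a n).

(* Main.v *)
(* Put W = X / sqrt n, let e be the unit vector along (1, .., 1), a = <We, e> and
   b = We - a e. If |Wx| <= K |x| for all x, then testing the Rayleigh quotient on
   e + b / lam from below, and bounding it by a 2 x 2 problem from above, gives
   lambda1 = lam + a + |b|^2 / lam + O(K^3 / lam^2). Here sqrt n * a is the sum of the
   entries of X divided by n, and |b|^2 - 1 is small in L^2 because E |b|^2 and
   E |b|^4 are explicit by Wick's formula.

   It remains to see that |W| is bounded in probability although the covariance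
   operator of the entries may have norm n^(1 - eps). By Wick's formula a moment of
   entries is bounded by the sum over pairings of products of delta + rho, where
   rho bounds the off-diagonal covariances, so E tr X^q is bounded by such a sum
   over walks. Pairing the first edge of a family of walks either splits a walk or
   glues two walks, and gluing costs a factor 1 / n; by induction
   E tr X^q <= n (16 sqrt n)^q as long as q is at most a power of log n. Markov's
   inequality with q of order log n bounds the norm. *)
Require Import Defs.
From HB Require Import structures.
From mathcomp Require Import all_boot all_order all_algebra.
From mathcomp Require Import all_classical all_reals all_analysis.
From mathcomp Require Import measurable_realfun ring lra zify.
Import Order.TTheory GRing.Theory Num.Def Num.Theory.
Import numFieldNormedType.Exports.

Set Implicit Arguments.
Unset Strict Implicit.
Unset Printing Implicit Defensive.

Local Open Scope classical_set_scope.
Local Open Scope ring_scope.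

(** * Sums over walks *)

(** The walks are left open and moments enter through their absolute values, so that one step of
    Wick's formula maps sums over families of walks to sums of the same kind: deleting an edge cuts
    a walk into two open walks, and the free end of the first edge is summed out against its
    partner. A genuine coincidence of edges fixes vertices, while a covariance [rho] fixes none; in
    gluing, this makes the relative weight of a partner edge [2 / n + n rho], up to powers of the
    length. With lengths of order log n this is small because [rho = O(n^(-1-eps))]; covariances of
    order [1 / n] would be out of reach of this argument.

    The Gaussian hypothesis speaks of single linear forms only. Their moment generating functions
    determine everything: expanding them to first order along further coefficient vectors produces
    Wick's formula.

    The remainder [V] is defined as the difference of the other terms, so the expansion itself is an
    identity and all work goes into tails. These are estimated for large [n]; each of the finitely
    many other indices is tight by itself. *)

Section Sums.
Variables (R : realFieldType) (V : finType).

(** The shape of one step of Wick's formula: the removed element is the partner, and the list passed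
    along is what remains to be paired. *)
Fixpoint removals (T : Type) (s : seq T) (psi : T -> seq T -> R) : R :=
  if s is f :: s' then psi f s' + removals s' (fun g t => psi g (f :: t)) else 0.

(** Deleting an edge of a walk leaves two nonempty walks, whence the test that rules out an empty
    second piece. *)
Fixpoint cuts (w : seq V) (chi : seq V -> seq V -> R) : R :=
  if w is x :: w' then
    (if w' is _ :: _ then chi [:: x] w' else 0) +
    cuts w' (fun w1 w2 => chi (x :: w1) w2)
  else 0.

(** Iterated sums rather than one sum over tuples: peeling off the first vertex is then a mere
    conversion. *)
Fixpoint tsum (m : nat) (phi : seq V -> R) : R :=
  if m is m'.+1 then \sum_x tsum m' (fun w => phi (x :: w)) else phi [::].

(* Sum over families of walks, [ls] listing their numbers of edges: a walk with
   [l] edges is its sequence of [l.+1] vertices. *)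
Fixpoint wsum (ls : seq nat) (phi : seq (seq V) -> R) : R :=
  if ls is l :: ls' then tsum l.+1 (fun w => wsum ls' (fun ws => phi (w :: ws)))
  else phi [::].

Lemma eq_tsum m phi psi : phi =1 psi -> tsum m phi = tsum m psi.
Proof.
elim: m phi psi => [|m IH] phi psi h /=; first exact: h.
by apply: eq_bigr => x _; apply: IH => w.
Qed.

Lemma eq_tsum_size m phi psi :
  (forall w, size w = m -> phi w = psi w) -> tsum m phi = tsum m psi.
Proof.
elim: m phi psi => [|m IH] phi psi h /=; first exact: h.
by apply: eq_bigr => x _; apply: IH => w sw; apply: h; rewrite /= sw.
Qed.

Lemma ler_tsum m phi psi :
  (forall w, size w = m -> phi w <= psi w) -> tsum m phi <= tsum m psi.
Proof.
elim: m phi psi => [|m IH] phi psi h /=; first exact: h.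
by apply: ler_sum => x _; apply: IH => w sw; apply: h; rewrite /= sw.
Qed.

Lemma tsumD m phi psi : tsum m (fun w => phi w + psi w) = tsum m phi + tsum m psi.
Proof.
elim: m phi psi => [|m IH] phi psi //=.
by rewrite -big_split; apply: eq_bigr => x _; rewrite IH.
Qed.

Lemma tsumZ m c phi : tsum m (fun w => c * phi w) = c * tsum m phi.
Proof.
elim: m phi => [|m IH] phi //=.
by rewrite mulr_sumr; apply: eq_bigr => x _; rewrite IH.
Qed.

Lemma tsum0 m : tsum m (fun=> 0) = 0.
Proof. by elim: m => [|m IH] //=; apply: big1 => x _; rewrite IH. Qed.

Lemma tsum_ge0 m phi : (forall w, 0 <= phi w) -> 0 <= tsum m phi.
Proof. by move=> h; rewrite -(tsum0 m); apply: ler_tsum. Qed.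

Lemma exchange_tsum_big (I : finType) m (phi : I -> seq V -> R) :
  \sum_i tsum m (phi i) = tsum m (fun w => \sum_i phi i w).
Proof.
elim: m phi => [|m IH] phi //=.
by rewrite exchange_big /=; apply: eq_bigr => x _; rewrite IH.
Qed.

Lemma exchange_tsum m1 m2 (phi : seq V -> seq V -> R) :
  tsum m1 (fun u => tsum m2 (phi u)) = tsum m2 (fun w => tsum m1 (fun u => phi u w)).
Proof.
elim: m1 phi => [|m IH] phi //=.
under eq_bigr do rewrite IH.
by rewrite exchange_tsum_big.
Qed.

Lemma tsum_cat m1 m2 phi :
  tsum (m1 + m2) phi = tsum m1 (fun u => tsum m2 (fun w => phi (u ++ w))).
Proof.
elim: m1 phi => [|m IH] phi; first exact: eq_tsum.
by rewrite addSn /=; apply: eq_bigr => x _; rewrite IH.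
Qed.

Lemma tsum_rev m phi : tsum m (fun w => phi (rev w)) = tsum m phi.
Proof.
elim: m phi => [|m IH] phi //.
rewrite -[in RHS]addn1 tsum_cat /= -exchange_tsum_big; apply: eq_bigr => x _.
by rewrite -[RHS]IH; apply: eq_tsum => w; rewrite rev_cons cats1.
Qed.

Lemma eq_wsum ls phi psi : phi =1 psi -> wsum ls phi = wsum ls psi.
Proof.
elim: ls phi psi => [|l ls IH] phi psi h; first exact: h.
by apply: eq_tsum => w; apply: IH => ws.
Qed.

Lemma ler_wsum ls phi psi : (forall ws, phi ws <= psi ws) -> wsum ls phi <= wsum ls psi.
Proof.
elim: ls phi psi => [|l ls IH] phi psi h; first exact: h.
by apply: ler_tsum => w _; apply: IH => ws.
Qed.

Lemma wsumD ls phi psi :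
  wsum ls (fun w => phi w + psi w) = wsum ls phi + wsum ls psi.
Proof.
elim: ls phi psi => [|l ls IH] phi psi //.
rewrite -[RHS]tsumD; apply: eq_tsum => w; exact: IH.
Qed.

Lemma wsumZ ls c phi : wsum ls (fun w => c * phi w) = c * wsum ls phi.
Proof.
elim: ls phi => [|l ls IH] phi //.
rewrite -[RHS]tsumZ; apply: eq_tsum => w; exact: IH.
Qed.

Lemma wsum0 ls : wsum ls (fun=> 0) = 0.
Proof.
elim: ls => [|l ls IH] //; rewrite -[RHS](tsum0 l.+1).
by apply: eq_tsum => w; exact: IH.
Qed.

Lemma wsum_ge0 ls phi : (forall w, 0 <= phi w) -> 0 <= wsum ls phi.
Proof. by move=> h; rewrite -(wsum0 ls); apply: ler_wsum. Qed.

Lemma exchange_wsum_tsum ls m (phi : seq (seq V) -> seq V -> R) :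
  wsum ls (fun ws => tsum m (phi ws)) = tsum m (fun w => wsum ls (fun ws => phi ws w)).
Proof.
elim: ls phi => [|l ls IH] phi //.
rewrite [RHS]exchange_tsum; apply: eq_tsum => w; exact: IH.
Qed.

Lemma ler_removals (T : Type) (s : seq T) (psi psi' : T -> seq T -> R) :
  (forall g t, psi g t <= psi' g t) -> removals s psi <= removals s psi'.
Proof.
elim: s psi psi' => [|f s IH] psi psi' h //=.
by apply: lerD => //; apply: IH.
Qed.

Lemma eq_removals (T : Type) (s : seq T) (psi psi' : T -> seq T -> R) :
  (forall g t, psi g t = psi' g t) -> removals s psi = removals s psi'.
Proof.
elim: s psi psi' => [|f s IH] psi psi' h //=.
by congr (_ + _) => //; apply: IH.
Qed.

Lemma removals_cat (T : Type) (s1 s2 : seq T) psi :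
  removals (s1 ++ s2) psi = removals s1 (fun g t => psi g (t ++ s2)) +
                      removals s2 (fun g t => psi g (s1 ++ t)).
Proof.
elim: s1 psi => [|f s IH] psi /=; first by rewrite add0r; apply: eq_removals.
by rewrite IH addrA.
Qed.

Lemma tsum_removals (T : Type) m (s : seq T) (psi : seq V -> T -> seq T -> R) :
  tsum m (fun w => removals s (psi w)) = removals s (fun g t => tsum m (fun w => psi w g t)).
Proof.
elim: s psi => [|f s IH] psi /=; first exact: tsum0.
by rewrite tsumD; congr (_ + _); exact: (IH (fun w g t => psi w g (f :: t))).
Qed.

Lemma wsum_removals (T : Type) ls (s : seq T) (psi : seq (seq V) -> T -> seq T -> R) :
  wsum ls (fun w => removals s (psi w)) = removals s (fun g t => wsum ls (fun w => psi w g t)).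
Proof.
elim: s psi => [|f s IH] psi /=; first exact: wsum0.
by rewrite wsumD; congr (_ + _); exact: (IH (fun w g t => psi w g (f :: t))).
Qed.

Lemma eq_cuts (w : seq V) (chi chi' : seq V -> seq V -> R) :
  (forall w1 w2, w1 != [::] -> w2 != [::] -> w = w1 ++ w2 -> chi w1 w2 = chi' w1 w2) ->
  cuts w chi = cuts w chi'.
Proof.
elim: w chi chi' => [|x w IH] chi chi' h //=; congr (_ + _).
  by case: w {IH} h => // y w h; apply: h.
by apply: IH => w1 w2 h1 h2 e; apply: h => //; rewrite e.
Qed.

(** Once the place of the cut is fixed, the two pieces range independently; [l.+1] vertices can be
    cut at [l] places. *)
Lemma tsum_cuts l chi :
  tsum l.+1 (fun w => cuts w chi) =
  \sum_(i < l) tsum i.+1 (fun w1 => tsum (l - i) (fun w2 => chi w1 w2)).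
Proof.
elim: l chi => [|l IH] chi.
  by rewrite big_ord0 /= big1 // => x _; rewrite addr0.
rewrite big_ord_recl subn0.
rewrite -[LHS]/(\sum_x tsum l.+1 (fun w => cuts (x :: w) chi)).
transitivity (\sum_x (tsum l.+1 (fun w2 => chi [:: x] w2) +
    \sum_(i < l) tsum i.+1 (fun w1 => tsum (l - i) (fun w2 => chi (x :: w1) w2)))).
  apply: eq_bigr => x _; rewrite -(IH (fun w1 => chi (x :: w1))) -tsumD.
  by apply: eq_tsum_size; case.
rewrite big_split; congr (_ + _); rewrite exchange_big.
by apply: eq_bigr => i _; rewrite lift0 subSS.
Qed.

End Sums.

(** * Wick pairings of edges in families of walks *)

Section Walks.
Variables (R : realFieldType) (V : finType) (E : eqType) (edge : V -> V -> E).
Hypothesis edgeC : forall u v, edge u v = edge v u.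
Hypothesis edge_inj : forall u v u' v', edge u v = edge u' v' ->
  (u = u' /\ v = v') \/ (u = v' /\ v = u').
Variables (x0 : V) (rho : R).
Hypothesis rho_ge0 : 0 <= rho.

Fixpoint edges (w : seq V) : seq E :=
  if w is x :: w' then
    if w' is y :: _ then edge x y :: edges w' else [::]
  else [::].

(** [x0] is a mere default for [last] and [head]: both walks are nonempty. *)
Lemma edges_cat (w1 w2 : seq V) : w1 != [::] -> w2 != [::] ->
  edges (w1 ++ w2) = edges w1 ++ edge (last x0 w1) (head x0 w2) :: edges w2.
Proof.
case: w1 => // x w1 _; case: w2 => // y w2 _.
by elim: w1 x => [|z w1 IH] x //=; rewrite -IH.
Qed.

Lemma edges_glue (w : seq V) x (v : seq V) :
  edges (rcons w x ++ v) = edges (rcons w x) ++ edges (x :: v).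
Proof.
case: v => [|y v]; first by rewrite !cats0.
by rewrite edges_cat //; [rewrite last_rcons|case: (w)].
Qed.

(** Two walks may have to be glued head to head, which traverses one of them backwards; edges are
    unordered, so nothing changes. *)
Lemma perm_edges_rev (w : seq V) : perm_eq (edges (rev w)) (edges w).
Proof.
elim: w => [|x w IH] //; case: w IH => [|y w] IH //.
rewrite rev_cons -cats1 edges_cat //; last by rewrite rev_cons; case: (rev w).
have -> : last x0 (rev (y :: w)) = y by rewrite rev_cons last_rcons.
by rewrite /= cats1 edgeC perm_rcons perm_cons.
Qed.

Lemma removals_edges (w : seq V) (psi : E -> seq E -> R) :
  removals (edges w) psi =
  cuts w (fun w1 w2 => psi (edge (last x0 w1) (head x0 w2)) (edges w1 ++ edges w2)).
Proof.
elim: w psi => [|x w IH] psi //; case: w IH => [|y w] IH; first by rewrite /= addr0.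
rewrite -[RHS]/(psi (edge x y) (edges (y :: w)) + cuts (y :: w) (fun w1 w2 =>
   psi (edge (last x0 (x :: w1)) (head x0 w2)) (edges (x :: w1) ++ edges w2))).
rewrite -[LHS]/(psi (edge x y) (edges (y :: w)) + removals (edges (y :: w))
   (fun g t => psi g (edge x y :: t))).
congr (_ + _); rewrite IH; apply: eq_cuts => -[|z w1] // w2 _ _ [<- _].
by [].
Qed.

Definition flat (ws : seq (seq V)) : seq E := flatten (map edges ws).

Definition ecov (e f : E) : R := (e == f)%:R + rho.

(** An edge and one of its ends determine the other end, so at most one term is nonzero. *)
Lemma sum_edge_eq (y : V) (g : E) : \sum_x ((edge x y == g)%:R : R) <= 1.
Proof.
have [/existsP[x /eqP xy]|/existsPn h] := boolP [exists x, edge x y == g].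
  rewrite (bigD1 x) //= xy eqxx big1 ?addr0 // => z zx.
  case: eqP => // zy; case: (edge_inj (etrans zy (esym xy))).
    by case=> zx' _; rewrite zx' eqxx in zx.
  by case=> zy' yx; rewrite zy' yx eqxx in zx.
by rewrite big1 // => x _; rewrite (negbTE (h x)).
Qed.

Lemma sum_ecov (y : V) (g : E) : \sum_x ecov (edge x y) g <= 1 + #|V|%:R * rho.
Proof.
by rewrite big_split sumr_const -[rho *+ _]mulr_natl /= lerD2r sum_edge_eq.
Qed.

(** Retains what [sum_ecov] forgets: for a coincidence, [y] has to be an end of the partner edge.
    This is the vertex lost when two walks are glued. *)
Lemma sum_ecov_ends (y p q : V) :
  \sum_x ecov (edge x y) (edge p q) <= (y == q)%:R + (y == p)%:R + #|V|%:R * rho.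
Proof.
rewrite big_split sumr_const -[rho *+ _]mulr_natl /= lerD2r.
have h z (c : bool) : \sum_x (((x == z) && c)%:R : R) <= c%:R.
  case: c; last by rewrite big1 // => x _; rewrite andbF.
  by rewrite (bigD1 z) //= eqxx big1 ?addr0 // => x /negbTE ->.
apply: (@le_trans _ _ (\sum_x (((x == p) && (y == q))%:R + ((x == q) && (y == p))%:R))).
  apply: ler_sum => x _; case: eqP => [/edge_inj [[-> ->]|[-> ->]]|_].
  - by rewrite !eqxx lerDl.
  - by rewrite !eqxx lerDr.
  - by rewrite addr_ge0.
by rewrite big_split lerD //; apply: h.
Qed.

Definition Wsum (b : seq E -> R) (ls : seq nat) : R := wsum ls (fun ws => b (flat ws)).

(** The constraint identifies the head of [v] with the end of [w], so [w] followed by [v] is a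
    single walk, with one vertex less than the two together. *)
Lemma glue_forward (b : seq E -> R) k i :
  (forall s t, perm_eq s t -> b s = b t) ->
  tsum k.+1 (fun v => tsum i.+1 (fun w =>
    (head x0 v == last x0 w)%:R * b (edges v ++ edges w))) =
  tsum (i + k).+1 (fun u : seq V => b (edges u)).
Proof.
move=> bp; rewrite -addSn tsum_cat exchange_tsum; apply: eq_tsum_size => w.
case/lastP: w => // w x _.
rewrite -[LHS]/(\sum_y tsum k (fun v => (y == last x0 (rcons w x))%:R *
  b (edges (y :: v) ++ edges (rcons w x)))) last_rcons.
rewrite (bigD1 x) //= [X in _ + X]big1 ?addr0 => [|y /negbTE yx].
  apply: eq_tsum => v; rewrite eqxx mul1r; apply: bp.
  by rewrite edges_glue perm_catC.
by rewrite yx -[RHS](tsum0 R V k); apply: eq_tsum => v; rewrite mul0r.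
Qed.

(** Summing over the reversal of [w] instead turns its head into its last vertex and only permutes
    its edges. *)
Lemma glue_backward (b : seq E -> R) k i :
  (forall s t, perm_eq s t -> b s = b t) ->
  tsum k.+1 (fun v => tsum i.+1 (fun w =>
    (head x0 v == head x0 w)%:R * b (edges v ++ edges w))) =
  tsum (i + k).+1 (fun u : seq V => b (edges u)).
Proof.
move=> bp; rewrite -glue_forward //; apply: eq_tsum => v.
rewrite -[RHS]tsum_rev; apply: eq_tsum_size => -[|x w] // _.
rewrite rev_cons last_rcons; congr (_ * _); apply: bp.
by rewrite perm_cat2l -rev_cons perm_sym perm_edges_rev.
Qed.

Let nrho := #|V|%:R * rho.

Lemma nrho_ge0 : 0 <= nrho.
Proof. by rewrite mulr_ge0. Qed.

(** The vertex [x] is summed out against the partner edge. That the head of [v] must also be an end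
    of that edge is dropped, at no cost in powers of [n]: two walks of total length [k - 1] weigh
    [n^2 theta^(k-1)], which for [theta^2] of order [n] is the order of one walk of length
    [k + 1]. *)
Lemma removals_own_bound (b : seq E -> R) k : (forall s, 0 <= b s) ->
  \sum_x tsum k.+1 (fun v => removals (edges v)
     (fun g t => ecov (edge x (head x0 v)) g * b t)) <=
  (1 + nrho) * \sum_(i < k) tsum i.+1 (fun w1 => tsum (k - i) (fun w2 =>
     b (edges w1 ++ edges w2))).
Proof.
move=> b0.
under eq_bigr => x _.
  rewrite (_ : tsum _ _ = \sum_(i < k) tsum i.+1 (fun w1 => tsum (k - i) (fun w2 =>
     ecov (edge x (head x0 w1)) (edge (last x0 w1) (head x0 w2)) *
     b (edges w1 ++ edges w2)))); last first.
    rewrite -(tsum_cuts k (fun w1 w2 =>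
       ecov (edge x (head x0 w1)) (edge (last x0 w1) (head x0 w2)) *
       b (edges w1 ++ edges w2))).
    apply: eq_tsum => v; rewrite removals_edges.
    by apply: eq_cuts => -[|y w1] // w2 _ _ ->.
  over.
rewrite exchange_big mulr_sumr; apply: ler_sum => i _.
rewrite exchange_tsum_big -tsumZ; apply: ler_tsum => w1 _.
rewrite exchange_tsum_big -tsumZ; apply: ler_tsum => w2 _.
by rewrite -mulr_suml ler_wpM2r // sum_ecov.
Qed.

(** Once [x] is summed out, a coincidence attaches [v] to one of the two pieces of [w] and leaves
    the other piece alone; the [rho] part attaches nothing and leaves three walks. The second piece
    has [l - i] vertices, hence [l.-1 - i] edges. *)
Lemma removals_pair_bound (b : seq E -> R) k l :
  (forall s, 0 <= b s) -> (forall s t, perm_eq s t -> b s = b t) ->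
  \sum_x tsum k.+1 (fun v => tsum l.+1 (fun w => removals (edges w)
     (fun g t => ecov (edge x (head x0 v)) g * b (edges v ++ t)))) <=
  \sum_(i < l)
    (tsum (i + k).+1 (fun u => tsum (l.-1 - i).+1 (fun w => b (edges u ++ edges w))) +
     tsum (l.-1 - i + k).+1 (fun u => tsum i.+1 (fun w => b (edges u ++ edges w))) +
     nrho * tsum k.+1 (fun v => tsum i.+1 (fun w1 => tsum (l.-1 - i).+1 (fun w2 =>
       b (edges v ++ (edges w1 ++ edges w2)))))).
Proof.
move=> b0 bp.
under eq_bigr => x _.
  rewrite (_ : tsum _ _ = \sum_(i < l) tsum k.+1 (fun v => tsum i.+1 (fun w1 =>
     tsum (l.-1 - i).+1 (fun w2 =>
     ecov (edge x (head x0 v)) (edge (last x0 w1) (head x0 w2)) *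
     b (edges v ++ (edges w1 ++ edges w2)))))); last first.
    rewrite exchange_tsum_big; apply: eq_tsum => v.
    transitivity (tsum l.+1 (fun w : seq V => cuts w (fun w1 w2 =>
       ecov (edge x (head x0 v)) (edge (last x0 w1) (head x0 w2)) *
       b (edges v ++ (edges w1 ++ edges w2))))).
      by apply: eq_tsum => w; rewrite removals_edges.
    rewrite tsum_cuts; apply: eq_bigr => i _.
    by rewrite (_ : (l - i)%N = (l.-1 - i).+1) //; have := ltn_ord i; lia.
  over.
rewrite exchange_big; apply: ler_sum => i _; set q := (l.-1 - i)%N.
rewrite exchange_tsum_big.
apply: (@le_trans _ _ (tsum k.+1 (fun v => tsum i.+1 (fun w1 => tsum q.+1 (fun w2 =>
   ((head x0 v == head x0 w2)%:R + (head x0 v == last x0 w1)%:R + nrho) *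
   b (edges v ++ (edges w1 ++ edges w2))))))).
  apply: ler_tsum => v _; rewrite exchange_tsum_big; apply: ler_tsum => w1 _.
  rewrite exchange_tsum_big; apply: ler_tsum => w2 _.
  by rewrite -mulr_suml ler_wpM2r // sum_ecov_ends.
rewrite le_eqVlt; apply/orP; left; apply/eqP.
pose T (c : seq V -> seq V -> seq V -> R) := tsum k.+1 (fun v => tsum i.+1 (fun w1 =>
   tsum q.+1 (fun w2 => c v w1 w2 * b (edges v ++ (edges w1 ++ edges w2))))).
transitivity (T (fun v _ w2 => (head x0 v == head x0 w2)%:R) +
              T (fun v w1 _ => (head x0 v == last x0 w1)%:R) + T (fun _ _ _ => nrho)).
  rewrite /T -!tsumD; apply: eq_tsum => v; rewrite -!tsumD; apply: eq_tsum => w1.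
  by rewrite -!tsumD; apply: eq_tsum => w2; rewrite !mulrDl.
congr (_ + _); first rewrite addrC; first congr (_ + _).
- rewrite -(glue_forward (b := fun s => tsum q.+1 (fun w2 => b (s ++ edges w2)))).
  + apply: eq_tsum => v; apply: eq_tsum => w1; rewrite -tsumZ.
    by apply: eq_tsum => w2; rewrite catA.
  + by move=> s t st; apply: eq_tsum => w; apply: bp; rewrite perm_cat2r.
- rewrite -(glue_backward (b := fun s => tsum i.+1 (fun w1 => b (s ++ edges w1)))).
  + apply: eq_tsum => v; rewrite exchange_tsum; apply: eq_tsum => w2; rewrite -tsumZ.
    apply: eq_tsum => w1; congr (_ * _); apply: bp.
    by rewrite -catA perm_cat2l perm_catC.
  + by move=> s t st; apply: eq_tsum => w; apply: bp; rewrite perm_cat2r.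
rewrite -tsumZ; apply: eq_tsum => v; rewrite -tsumZ; apply: eq_tsum => w1.
by rewrite -tsumZ.
Qed.

Lemma removals_glue_bound (b : seq E -> R) k ls :
  (forall s, 0 <= b s) -> (forall s t, perm_eq s t -> b s = b t) ->
  \sum_x tsum k.+1 (fun v => wsum ls (fun ws => removals (flat ws)
     (fun g t => ecov (edge x (head x0 v)) g * b (edges v ++ t)))) <=
  removals ls (fun l ls' => \sum_(i < l)
    (Wsum b [:: (i + k)%N, (l.-1 - i)%N & ls'] +
     Wsum b [:: (l.-1 - i + k)%N, i : nat & ls'] +
     nrho * Wsum b [:: k, i : nat, (l.-1 - i)%N & ls'])).
Proof.
elim: ls b => [|l ls IH] b b0 bp.
  by rewrite big1 // => x _; rewrite -[RHS](tsum0 R V k.+1).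
(* If the partner lies in the current walk, the later walks are spectators and are summed inside
   [B]. Otherwise the current walk is the spectator, summed inside [B'], to which the induction
   hypothesis applies. *)
pose B s := wsum ls (fun ws : seq (seq V) => b (s ++ flat ws)).
pose B' s := tsum l.+1 (fun w : seq V => b (edges w ++ s)).
rewrite -[leRHS]/(_ + _).
apply: (@le_trans _ _ (
  \sum_x tsum k.+1 (fun v => tsum l.+1 (fun w => removals (edges w)
     (fun g t => ecov (edge x (head x0 v)) g * B (edges v ++ t)))) +
  \sum_x tsum k.+1 (fun v => wsum ls (fun ws => removals (flat ws)
     (fun g t => ecov (edge x (head x0 v)) g * B' (edges v ++ t)))))).
  rewrite -big_split le_eqVlt; apply/orP; left; apply/eqP; apply: eq_bigr => x _.
  rewrite -[RHS]/(tsum k.+1 _ + tsum k.+1 _) -tsumD; apply: eq_tsum => v.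
  rewrite -[LHS]/(tsum l.+1 (fun w => wsum ls (fun ws => removals (edges w ++ flat ws)
     (fun g t => ecov (edge x (head x0 v)) g * b (edges v ++ t))))).
  transitivity (tsum l.+1 (fun w =>
      wsum ls (fun ws => removals (edges w) (fun g t =>
        ecov (edge x (head x0 v)) g * b (edges v ++ (t ++ flat ws)))) +
      wsum ls (fun ws => removals (flat ws) (fun g t =>
        ecov (edge x (head x0 v)) g * b (edges v ++ (edges w ++ t)))))).
    apply: eq_tsum => w; rewrite -wsumD; apply: eq_wsum => ws.
    by rewrite removals_cat.
  rewrite tsumD; congr (_ + _).
    apply: eq_tsum => w; rewrite wsum_removals; apply: eq_removals => g t.
    by rewrite wsumZ; congr (_ * _); apply: eq_wsum => ws; rewrite catA.
  rewrite -exchange_wsum_tsum; apply: eq_wsum => ws.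
  rewrite tsum_removals; apply: eq_removals => g t.
  rewrite tsumZ; congr (_ * _); apply: eq_tsum => w; apply: bp.
  by rewrite !catA perm_cat2r perm_catC.
apply: lerD.
  apply: (le_trans (removals_pair_bound _ _ _ _)).
  - by move=> s; apply: wsum_ge0.
  - by move=> s t st; apply: eq_wsum => w; apply: bp; rewrite perm_cat2r.
  apply: ler_sum => i _; rewrite le_eqVlt; apply/orP; left; apply/eqP.
  congr (_ + _ + _ * _).
  - by apply: eq_tsum => u; apply: eq_tsum => w; apply: eq_wsum => ws; rewrite -catA.
  - by apply: eq_tsum => u; apply: eq_tsum => w; apply: eq_wsum => ws; rewrite -catA.
  - apply: eq_tsum => u; apply: eq_tsum => w; apply: eq_tsum => w'; apply: eq_wsum => ws.
    by rewrite -!catA.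
have B0 s : 0 <= B' s by apply: tsum_ge0.
have Bp s t : perm_eq s t -> B' s = B' t.
  by move=> st; apply: eq_tsum => w; apply: bp; rewrite perm_cat2l.
apply: (le_trans (IH _ B0 Bp)).
have aux p q t : Wsum B' [:: p, q & t] = Wsum b [:: p, q, l & t].
  apply: eq_tsum => u; apply: eq_tsum => w; rewrite [LHS]exchange_wsum_tsum.
  apply: eq_tsum => w'; apply: eq_wsum => ws; apply: bp.
  rewrite perm_catC -!catA perm_cat2l perm_cat2l perm_catC.
  by rewrite perm_refl.
have aux' p q q' t : Wsum B' [:: p, q, q' & t] = Wsum b [:: p, q, q', l & t].
  apply: eq_tsum => u; apply: eq_tsum => w; apply: eq_tsum => w2.
  rewrite [LHS]exchange_wsum_tsum.
  apply: eq_tsum => w'; apply: eq_wsum => ws; apply: bp.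
  rewrite perm_catC -!catA !perm_cat2l perm_catC.
  by rewrite perm_refl.
rewrite le_eqVlt; apply/orP; left; apply/eqP; apply: eq_removals => m t.
by apply: eq_bigr => i _; rewrite aux' !aux.
Qed.

(* Pairing the first edge of the first walk with another edge of that walk splits
   the walk; pairing it with an edge of another walk glues the two. *)
Lemma Wsum_cons (a : seq E -> R) k ls :
  (forall s, 0 <= a s) -> (forall s t, perm_eq s t -> a s = a t) ->
  (forall e s, a (e :: s) <= removals s (fun g t => ecov e g * a t)) ->
  Wsum a (k.+1 :: ls) <=
  (1 + nrho) * \sum_(i < k) Wsum a [:: i : nat, (k.-1 - i)%N & ls] +
  removals ls (fun l ls' => \sum_(i < l)
    (Wsum a [:: (i + k)%N, (l.-1 - i)%N & ls'] +
     Wsum a [:: (l.-1 - i + k)%N, i : nat & ls'] +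
     nrho * Wsum a [:: k, i : nat, (l.-1 - i)%N & ls'])).
Proof.
move=> a0 ap aw.
pose B s := wsum ls (fun ws : seq (seq V) => a (s ++ flat ws)).
apply: le_trans (lerD _ (removals_glue_bound k ls a0 ap)); last first.
  apply: le_trans (removals_own_bound (b := B) k _) _; first by move=> s; apply: wsum_ge0.
  rewrite ler_wpM2l ?addr_ge0 ?nrho_ge0 //; apply: ler_sum => i _.
  rewrite le_eqVlt; apply/orP; left; apply/eqP.
  rewrite (_ : (k - i)%N = (k.-1 - i).+1); last by have := ltn_ord i; lia.
  by apply: eq_tsum => u; apply: eq_tsum => w; apply: eq_wsum => ws; rewrite -catA.
rewrite -big_split; apply: ler_sum => x _.
rewrite -[leRHS]/(tsum k.+1 _ + tsum k.+1 _) -tsumD.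
rewrite -[leLHS]/(tsum k.+1 (fun v => wsum ls (fun ws => a (edges (x :: v) ++ flat ws)))).
apply: ler_tsum => -[//|y v _]; rewrite /B.
apply: (@le_trans _ _ (wsum ls (fun ws =>
    removals (edges (y :: v)) (fun g t => ecov (edge x y) g * a (t ++ flat ws)) +
    removals (flat ws) (fun g t => ecov (edge x y) g * a (edges (y :: v) ++ t))))).
  apply: ler_wsum => ws; have := aw (edge x y) (edges (y :: v) ++ flat ws).
  by rewrite removals_cat.
rewrite wsumD lerD2r wsum_removals; apply: ler_removals => g t.
by rewrite wsumZ.
Qed.

Let n : R := #|V|%:R.

(* Up to the power of [theta], convolving [1 / l.+1 ^ 2] with itself reproduces
   it up to a constant, as for the Catalan numbers. *)
Definition wt (theta : R) (l : nat) : R := n * theta ^+ l / l.+1%:R ^+ 2.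

Lemma wt_ge0 theta l : 0 <= theta -> 0 <= wt theta l.
Proof. by move=> h; rewrite !mulr_ge0 ?invr_ge0 ?exprn_ge0. Qed.

Lemma wt_le theta l : 0 <= theta -> wt theta l <= n * theta ^+ l.
Proof.
move=> h; rewrite ler_piMr ?mulr_ge0 ?exprn_ge0 // invf_le1 ?exprn_gt0 //.
by rewrite -natrX ler1n expn_gt0.
Qed.

Lemma sum_inv_sq k : \sum_(i < k) (i.+1%:R ^+ 2)^-1 <= 2 :> R.
Proof.
case: k => [|k]; first by rewrite big_ord0.
(* Strengthened so that the induction telescopes. *)
suff h : \sum_(i < k.+1) (i.+1%:R ^+ 2)^-1 <= 2 - (k.+1%:R)^-1 :> R.
  by apply: (le_trans h); rewrite lerBlDr lerDl invr_ge0.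
elim: k => [|k IH]; first by rewrite big_ord1 expr1n invr1; lra.
rewrite big_ord_recr /=.
have hk : 0 < k.+1%:R :> R by [].
have -> : k.+2%:R = k.+1%:R + 1 :> R by rewrite -natr1.
apply: le_trans (lerD IH (lexx _)) _.
set z := (k.+1)%:R in hk *; clearbody z.
have hz : 0 < z + 1 by lra.
rewrite -subr_ge0.
have -> : 2 - (z + 1)^-1 - (2 - z^-1 + ((z + 1) ^+ 2)^-1) = (z * (z + 1) ^+ 2)^-1.
  by field; rewrite !gt_eqF.
by rewrite invr_ge0 mulr_ge0 ?exprn_ge0 ?ltW.
Qed.

(** Since [2 (x^2 + y^2) >= (x + y)^2], one has [1 / (x y)^2 <= 2 (1 / x^2 + 1 / y^2) / (x + y)^2].
    Here [x + y] does not depend on the index, so the convolution decouples into two copies of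
    [sum_inv_sq]. The constant 64 is generous. *)
Lemma wt_conv theta k : 0 < n -> 0 < theta ->
  \sum_(i < k) wt theta i * wt theta (k.-1 - i) <=
  64 * n / theta ^+ 2 * wt theta k.+1.
Proof.
move=> n0 t0; have n0' := ltW n0; have t0' := ltW t0.
case: k => [|k]; first by rewrite big_ord0 !mulr_ge0 ?wt_ge0 ?invr_ge0 ?exprn_ge0 // ltW.
have k1 : 0 < k.+2%:R :> R by [].
have hterm (i : 'I_k.+1) : wt theta i * wt theta (k - i) <=
   n ^+ 2 * theta ^+ k * (2 / k.+2%:R ^+ 2 *
    ((i.+1%:R ^+ 2)^-1 + ((k - i).+1%:R ^+ 2)^-1)).
  rewrite /wt.
  have -> : theta ^+ k = theta ^+ i * theta ^+ (k - i).
    by rewrite -exprD subnKC // -ltnS.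
  have -> : k.+2%:R = i.+1%:R + (k - i).+1%:R :> R.
    by rewrite -natrD; congr (_%:R); have := ltn_ord i; lia.
  set x := i.+1%:R; set y := (k - i).+1%:R; set u := theta ^+ i; set v := theta ^+ _.
  have x0' : 0 < x by rewrite ltr0n.
  have y0' : 0 < y by rewrite ltr0n.
  clearbody x y.
  have -> : n * u / x ^+ 2 * (n * v / y ^+ 2) = n ^+ 2 * (u * v) * ((x ^+ 2 * y ^+ 2)^-1).
    by field; rewrite !gt_eqF.
  rewrite ler_wpM2l ?mulr_ge0 ?exprn_ge0 ?invr_ge0 //.
  have xy : 0 < x + y by lra.
  rewrite -subr_ge0.
  have -> : 2 / (x + y) ^+ 2 * ((x ^+ 2)^-1 + (y ^+ 2)^-1) - (x ^+ 2 * y ^+ 2)^-1 =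
     (x - y) ^+ 2 / ((x + y) ^+ 2 * x ^+ 2 * y ^+ 2).
    by field; rewrite !gt_eqF.
  by rewrite -!exprMn divr_ge0 ?sqr_ge0.
apply: le_trans (ler_sum _ (fun i _ => hterm i)) _.
rewrite -!mulr_sumr big_split /=.
have e : \sum_(i < k.+1) ((k - i).+1%:R ^+ 2)^-1 = \sum_(i < k.+1) (i.+1%:R ^+ 2)^-1 :> R.
  rewrite [RHS](reindex_inj rev_ord_inj) /=.
  by apply: eq_bigr => i _; rewrite subSS.
rewrite e; have h := sum_inv_sq k.+1.
rewrite /wt -[k.+3%:R]natr1.
set z := k.+2%:R in k1 *; set S := \sum_(i < _) _ in h *.
have zz : 1 <= z by rewrite ler1n.
clearbody z; have z10 : 0 < z + 1 by lra.
have -> : theta ^+ k.+2 = theta ^+ k * theta ^+ 2 by rewrite -exprD addn2.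
have -> : 64 * n / theta ^+ 2 * (n * (theta ^+ k * theta ^+ 2) / (z + 1) ^+ 2) =
   n ^+ 2 * theta ^+ k * (64 / (z + 1) ^+ 2).
  by field; rewrite !gt_eqF.
rewrite ler_wpM2l ?mulr_ge0 ?exprn_ge0 ?invr_ge0 //.
apply: (@le_trans _ _ (2 / z ^+ 2 * 4)).
  by rewrite ler_wpM2l ?divr_ge0 ?exprn_ge0 //; lra.
rewrite -subr_ge0.
have -> : 64 / (z + 1) ^+ 2 - 2 / z ^+ 2 * 4 =
    (64 * z ^+ 2 - 8 * (z + 1) ^+ 2) / (z ^+ 2 * (z + 1) ^+ 2).
  by field; rewrite !gt_eqF.
by rewrite divr_ge0 ?mulr_ge0 ?sqr_ge0 //; nra.
Qed.

(** The bound is asked only for [l :: t] a permutation of [s], so that sums and products over [s]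
    can be rewritten in terms of [l] and [t]. *)
Lemma removals_le (T : eqType) (s : seq T) psi (c : T -> R) p :
  (forall l t, perm_eq (l :: t) s -> psi l t <= c l * p) ->
  removals s psi <= (\sum_(l <- s) c l) * p.
Proof.
elim: s psi => [|f s IH] psi h /=; first by rewrite big_nil mul0r.
rewrite big_cons mulrDl lerD ?h //; apply: IH => l t lt; apply: h.
apply: (@perm_trans _ (f :: l :: t)); last by rewrite perm_cons.
by rewrite -(cat1s l) -(cat1s f) perm_catCA.
Qed.

(* Splitting is absorbed by [wt_conv]; gluing loses a vertex, hence a factor
   [1 / n] that beats all powers of the total length. *)
Lemma Wsum_bound (a : seq E -> R) (theta : R) (N : nat) :
  (forall s, 0 <= a s) -> (forall s t, perm_eq s t -> a s = a t) ->
  a [::] <= 1 ->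
  (forall e s, a (e :: s) <= removals s (fun g t => ecov e g * a t)) ->
  0 < n -> 0 < theta -> 256 * n <= theta ^+ 2 -> nrho <= 1 ->
  N.+1%:R ^+ 5 * (2 + n * nrho) <= 128 * n ->
  forall ls, (sumn ls <= N)%N -> Wsum a ls <= \prod_(l <- ls) wt theta l.
Proof.
move=> a0 ap a1 aw n0 t0 nt r1 hN ls; have n0' := ltW n0; have t0' := ltW t0.
have wt0 l : 0 <= wt theta l by rewrite wt_ge0 // ltW.
(* A pairing removes two edges and creates at most one walk, so edges plus walks decrease; they also
   decrease when a walk without edges is summed out, which gives the factor [n]. *)
have [m] := ubnP (sumn ls + size ls); elim: m ls => // m IH [|[|k] ls] lm lN.
- by rewrite big_nil.
- rewrite big_cons /wt expr0 expr1n mulr1 divr1.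
  rewrite /Wsum -[leLHS]/(\sum_x Wsum a ls) sumr_const -mulr_natl ler_wpM2l //.
  by apply: IH; clear -lm lN; move: lm lN => /=; lia.
have IH' ls' : (sumn ls' <= N)%N -> (sumn ls' + size ls' < sumn ls + size ls + k.+2)%N ->
    Wsum a ls' <= \prod_(l <- ls') wt theta l.
  by move=> h1 h2; apply: IH => //; clear -lm h2; move: lm => /=; lia.
apply: le_trans (Wsum_cons k ls a0 ap aw) _.
rewrite big_cons; set P := \prod_(l <- ls) _.
have P0 : 0 <= P by apply: prodr_ge0.
(* One half of the target pays for splitting, the other for gluing. *)
have -> : wt theta k.+1 * P = wt theta k.+1 * P / 2 + wt theta k.+1 * P / 2 by field.
apply: lerD.
  (* The factor 2 bounds [1 + nrho], and 256 in the hypothesis on [theta] is what makes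
     [2 * 64 * n / theta ^+ 2] at most one half. *)
  apply: (@le_trans _ _ (2 * (64 * n / theta ^+ 2 * wt theta k.+1) * P)); last first.
    rewrite [leRHS]mulrAC ler_wpM2r //.
    have : n / theta ^+ 2 <= 256^-1 by rewrite ler_pdivrMr ?exprn_gt0 //; lra.
    rewrite (_ : 2 * _ = 128 * (n / theta ^+ 2 * wt theta k.+1)); last by ring.
    move=> /(ler_wpM2r (wt0 k.+1)) h.
    apply: le_trans (ler_wpM2l (ler0n _ 128) h) _.
    by rewrite mulrA (_ : 128 * 256^-1 = 2^-1) 1?mulrC //; field.
  have hs : \sum_(i < k) Wsum a [:: i : nat, (k.-1 - i)%N & ls] <=
      64 * n / theta ^+ 2 * wt theta k.+1 * P.
    apply: (@le_trans _ _ (\sum_(i < k) wt theta i * wt theta (k.-1 - i) * P)).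
      apply: ler_sum => i _; apply: (le_trans (IH' _ _ _)).
      - by clear -lN; have := ltn_ord i; move: lN => /=; lia.
      - by clear; have := ltn_ord i => /=; lia.
      by rewrite !big_cons mulrA.
    by rewrite -mulr_suml ler_wpM2r // wt_conv.
  apply: (le_trans (ler_wpM2l _ hs)); first by rewrite addr_ge0 ?nrho_ge0.
  rewrite -[leRHS]mulrA ler_wpM2r ?lerD2l //.
  by rewrite mulr_ge0 // mulr_ge0 // divr_ge0 ?exprn_ge0 // mulr_ge0.
have n256 : 0 < 256 * n by apply: mulr_gt0; [rewrite ltr0n|exact: n0].
(* Estimating the new walks by [wt_le] gives up the denominators of [wt]; restoring those of the two
   original walks costs the fourth power. The fifth power in the hypothesis counts the possible
   partner edges. *)
pose kappa := N.+1%:R ^+ 4 * (2 + n * nrho) / (256 * n).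
have nn0 : 0 <= n * nrho by rewrite mulr_ge0 ?nrho_ge0 // ltW.
have kappa0 : 0 <= kappa.
  by rewrite /kappa divr_ge0 ?(ltW n256) // mulr_ge0 ?exprn_ge0 // addr_ge0.
apply: (@le_trans _ _ ((\sum_(l <- ls) l%:R * kappa) * (wt theta k.+1 * P))); last first.
  rewrite [leRHS]mulrC ler_wpM2r ?(mulr_ge0 (wt0 _) P0) // -mulr_suml -natr_sum -sumnE.
  rewrite -(ler_pM2r n256).
  rewrite /kappa mulrA divfK ?(gt_eqF n256) //.
  have -> : 2^-1 * (256 * n) = 128 * n by field.
  apply: le_trans hN; rewrite mulrA ler_wpM2r ?addr_ge0 // (exprS _ 4) ler_wpM2r ?exprn_ge0 //.
  by rewrite ler_nat; clear -lN; move: lN => /=; lia.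
set psi := (X in removals _ X).
suff key (l : nat) (ls' : seq nat) : perm_eq (l :: ls') ls ->
    psi l ls' <= l%:R * kappa * (wt theta k.+1 * P) by exact: removals_le.
rewrite /psi => pl {psi}.
have -> : P = wt theta l * \prod_(m <- ls') wt theta m.
  by rewrite /P -(perm_big _ pl) big_cons.
set Q := \prod_(m <- ls') _.
have Q0 : 0 <= Q by apply: prodr_ge0.
have sl : sumn ls = (l + sumn ls')%N by rewrite -(perm_sumn pl).
have szl : size ls = (size ls').+1 by rewrite -(perm_size pl).
move: lN; rewrite /= sl => lN.
apply: (@le_trans _ _ (\sum_(i < l) (2 + n * nrho) * (n ^+ 2 * theta ^+ (k + l).-1) * Q)).
  apply: ler_sum => i _; have li := ltn_ord i.
  have two p q : (p + q = (k + l).-1)%N ->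
      Wsum a [:: p, q & ls'] <= n ^+ 2 * theta ^+ (k + l).-1 * Q.
    move=> pq; apply: (le_trans (IH' _ _ _)).
    - by rewrite /=; clear -li lN pq; lia.
    - by rewrite /= sl szl; clear -li pq; lia.
    rewrite !big_cons mulrA ler_wpM2r // -pq exprD.
    have -> : n ^+ 2 * (theta ^+ p * theta ^+ q) = (n * theta ^+ p) * (n * theta ^+ q) by ring.
    by apply: ler_pM; [exact: wt0|exact: wt0|exact: wt_le|exact: wt_le].
  have three : Wsum a [:: k, i : nat, (l.-1 - i)%N & ls'] <=
      n * (n ^+ 2 * theta ^+ (k + l).-1) * Q.
    apply: (le_trans (IH' _ _ _)).
    - by rewrite /=; clear -li lN; lia.
    - by rewrite /= sl szl; clear -li; lia.
    rewrite !big_cons 2!mulrA ler_wpM2r //.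
    have -> : (k + l).-1 = (k + i + (l.-1 - i))%N by clear -li; lia.
    have -> : n * (n ^+ 2 * theta ^+ (k + i + (l.-1 - i))) =
        (n * theta ^+ k) * (n * theta ^+ i) * (n * theta ^+ (l.-1 - i)).
      by rewrite !exprD; ring.
    apply: ler_pM; [exact: mulr_ge0|exact: wt0| |exact: wt_le].
    by apply: ler_pM; [exact: wt0|exact: wt0|exact: wt_le|exact: wt_le].
  have h1 : Wsum a [:: (i + k)%N, (l.-1 - i)%N & ls'] <= n ^+ 2 * theta ^+ (k + l).-1 * Q.
    by apply: two; clear -li; lia.
  have h2 : Wsum a [:: (l.-1 - i + k)%N, i : nat & ls'] <= n ^+ 2 * theta ^+ (k + l).-1 * Q.
    by apply: two; clear -li; lia.
  have h3 := ler_wpM2l nrho_ge0 three.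
  apply: le_trans (lerD (lerD h1 h2) h3) _.
  by rewrite le_eqVlt; apply/orP; left; apply/eqP; ring.
rewrite sumr_const card_ord -[leLHS]mulr_natl -[leRHS]mulrA.
case: l lN pl {sl} => [|l] lN pl; first by rewrite !mul0r.
suff main : (2 + n * nrho) * (n ^+ 2 * theta ^+ (k + l.+1).-1) <=
    kappa * (wt theta k.+1 * wt theta l.+1).
  rewrite ler_wpM2l //.
  by have := ler_wpM2r Q0 main; rewrite -!mulrA.
have hk : k.+2%:R <= N.+1%:R :> R by rewrite ler_nat; clear -lN; lia.
have hl : l.+2%:R <= N.+1%:R :> R by rewrite ler_nat; clear -lN; lia.
have hk0 : 0 < k.+2%:R :> R by [].
have hl0 : 0 < l.+2%:R :> R by [].
have hN0 : 0 < N.+1%:R :> R by [].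
rewrite addnS /kappa /wt.
set x := k.+2%:R in hk hk0 *; set y := l.+2%:R in hl hl0 *; set z := N.+1%:R in hk hl hN0 *.
clearbody x y z.
have -> : theta ^+ (k + l) = theta ^+ k * theta ^+ l by rewrite exprD.
rewrite (exprS _ k) (exprS _ l); set u := theta ^+ k; set v := theta ^+ l.
have -> : z ^+ 4 * (2 + n * nrho) / (256 * n) *
    (n * (theta * u) / x ^+ 2 * (n * (theta * v) / y ^+ 2))
  = (2 + n * nrho) * (n ^+ 2 * (u * v)) *
    (theta ^+ 2 / (256 * n) * (z ^+ 2 / x ^+ 2) * (z ^+ 2 / y ^+ 2)).
  by field; rewrite !gt_eqF.
rewrite -[leLHS]mulr1 ler_wpM2l ?mulr_ge0 ?addr_ge0 ?exprn_ge0 //.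
have h1 : 1 <= theta ^+ 2 / (256 * n) by rewrite (ler_pdivlMr _ _ n256) mul1r.
have h2 w : 0 < w -> w <= z -> 1 <= z ^+ 2 / w ^+ 2.
  move=> w0 wz; rewrite ler_pdivlMr ?exprn_gt0 // mul1r.
  by apply: lerXn2r => //; rewrite nnegrE ltW.
by apply: mulr_ege1; [apply: mulr_ege1 => //; exact: h2|exact: h2].
Qed.

End Walks.

(** * Largest eigenvalue of a symmetric matrix *)

Section Dot.
Variables (R : realType) (n : nat).
Implicit Types (x y z : 'rV[R]_n) (A B : 'M[R]_n).

Definition dot x y : R := (x *m y^T) 0 0.

Lemma dotE x y : dot x y = \sum_i x 0 i * y 0 i.
Proof. by rewrite /dot mxE; apply: eq_bigr => i _; rewrite mxE. Qed.

Lemma dotC x y : dot x y = dot y x.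
Proof. by rewrite !dotE; apply: eq_bigr => i _; rewrite mulrC. Qed.

Lemma dotDl x y z : dot (x + y) z = dot x z + dot y z.
Proof. by rewrite /dot mulmxDl mxE. Qed.

Lemma dotDr x y z : dot x (y + z) = dot x y + dot x z.
Proof. by rewrite !(dotC x) dotDl. Qed.

Lemma dotZl a x y : dot (a *: x) y = a * dot x y.
Proof. by rewrite /dot -scalemxAl mxE. Qed.

Lemma dotZr a x y : dot x (a *: y) = a * dot x y.
Proof. by rewrite !(dotC x) dotZl. Qed.

Lemma dotBl x y z : dot (x - y) z = dot x z - dot y z.
Proof. by rewrite dotDl -scaleN1r dotZl mulN1r. Qed.

Lemma dotBr x y z : dot x (y - z) = dot x y - dot x z.
Proof. by rewrite !(dotC x) dotBl. Qed.

Lemma dot_ge0 x : 0 <= dot x x.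
Proof. by rewrite dotE sumr_ge0 // => i _; rewrite -expr2 sqr_ge0. Qed.

Lemma dot_gt0 x : x != 0 -> 0 < dot x x.
Proof.
move=> x0; rewrite lt_def dot_ge0 andbT; apply: contra x0 => /eqP.
rewrite dotE => /psumr_eq0P h; apply/eqP/rowP => i; rewrite mxE; apply/eqP.
by rewrite -sqrf_eq0 expr2 h // => j _; rewrite -expr2 sqr_ge0.
Qed.

Lemma dot0l x : dot 0 x = 0.
Proof. by rewrite -(scale0r 0) dotZl mul0r. Qed.

Lemma dot_mulmx x y A : dot (x *m A) y = dot x (y *m A^T).
Proof. by rewrite /dot trmx_mul trmxK mulmxA. Qed.

(** Semidefinite rather than definite, as it is needed for [q%:M - A] with [q] the supremum of the
    Rayleigh quotient. *)
Lemma psd_cauchy_schwarz B x y : B^T = B ->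
  (forall z, 0 <= dot (z *m B) z) ->
  dot (x *m B) y ^+ 2 <= dot (x *m B) x * dot (y *m B) y.
Proof.
move=> sB psd.
set p := dot (x *m B) x; set q := dot (y *m B) y; set r := dot (x *m B) y.
have quad s t : 0 <= s ^+ 2 * p + 2 * s * t * r + t ^+ 2 * q.
  have := psd (s *: x + t *: y).
  rewrite mulmxDl -!scalemxAl !(dotDl, dotDr, dotZl, dotZr) -/p -/q -/r.
  rewrite (dot_mulmx y x) sB (dotC y) -/r; congr (0 <= _); ring.
have p0 : 0 <= p by apply: psd.
have q0 : 0 <= q by apply: psd.
have [q0e|qn0] := eqVneq q 0.
  (* For [q = 0] the form is linear in the second coefficient; these values turn it into
     [- (p + 2) r^2], which forces [r = 0]. *)
  have := quad r (- (p + 1)); rewrite q0e.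
  have -> : r ^+ 2 * p + 2 * r * (- (p + 1)) * r + (- (p + 1)) ^+ 2 * 0 =
    - (p + 2) * r ^+ 2 by ring.
  by rewrite mulNr oppr_ge0 mulr0 pmulr_rle0 // ltr_wpDl.
have q1 : 0 < q by rewrite lt_def qn0.
have := quad q (- r).
have -> : q ^+ 2 * p + 2 * q * (- r) * r + (- r) ^+ 2 * q = q * (p * q - r ^+ 2) by ring.
by rewrite pmulr_rge0 // subr_ge0.
Qed.

Lemma dot_cauchy_schwarz x y : dot x y ^+ 2 <= dot x x * dot y y.
Proof.
have := @psd_cauchy_schwarz 1%:M x y; rewrite !mulmx1 tr_scalar_mx; apply => // z.
by rewrite mulmx1 dot_ge0.
Qed.

Definition frob A : R := \sum_i \sum_j A i j ^+ 2.

Lemma frob_ge0 A : 0 <= frob A.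
Proof. by do 2 apply: sumr_ge0 => ? _; rewrite sqr_ge0. Qed.

Lemma dot_mulmx_le x A : dot (x *m A) (x *m A) <= frob A * dot x x.
Proof.
rewrite dotE /frob exchange_big mulr_suml; apply: ler_sum => j _.
rewrite -expr2 -[X in _ <= X * _](_ : dot (col j A)^T (col j A)^T = _); last first.
  by rewrite dotE; apply: eq_bigr => i _; rewrite !mxE expr2.
rewrite mulrC; apply: le_trans (dot_cauchy_schwarz _ _).
by rewrite dotE [X in X ^+ 2 <= _]mxE; under [in leRHS]eq_bigr do rewrite !mxE.
Qed.

Lemma frobE A : A^T = A -> frob A = \tr (A *m A).
Proof.
move=> sA; rewrite /mxtrace; apply: eq_bigr => i _; rewrite mxE.
by apply: eq_bigr => j _; rewrite -[in RHS]sA [in X in _ * X]mxE sA expr2.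
Qed.

End Dot.

Section Lambda1.
Variables (R : realType) (n : nat).
Implicit Types (x y z : 'rV[R]_n.+1) (A B : 'M[R]_n.+1).

Lemma sqr_le_sqr_abs (u v : R) : 0 <= v -> u ^+ 2 <= v ^+ 2 -> `|u| <= v.
Proof.
move=> v0 h; rewrite -(ler_pXn2r (ltn0Sn 1)) ?nnegrE //.
by rewrite real_normK ?num_real.
Qed.

(** Deliberately crude: [frob A <= (frob A + 1)^2] avoids a square root, and only finiteness of the
    bound matters. *)
Lemma dot_mulmx_abs x A : `|dot (x *m A) x| <= (frob A + 1) * dot x x.
Proof.
apply: sqr_le_sqr_abs; first by rewrite mulr_ge0 ?dot_ge0 ?addr_ge0 ?frob_ge0.
apply: (le_trans (dot_cauchy_schwarz _ _)).
rewrite exprMn [in leRHS]expr2 [in leRHS]expr2 [leRHS]mulrA ler_wpM2r ?dot_ge0 //.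
apply: (le_trans (dot_mulmx_le _ _)); rewrite ler_wpM2r ?dot_ge0 //.
by have := frob_ge0 A; set f := frob A; nra.
Qed.

Definition rayleigh A : set R := [set r | exists2 x, x != 0 & r = dot (x *m A) x / dot x x].

Lemma has_sup_rayleigh A : has_sup (rayleigh A).
Proof.
split.
  pose u : 'rV[R]_n.+1 := const_mx 1.
  exists (dot (u *m A) u / dot u u).
  by exists u => //; apply/eqP => /rowP /(_ 0); rewrite !mxE => /eqP; rewrite oner_eq0.
exists (frob A + 1) => _ [x x0 ->].
by rewrite ler_pdivrMr ?dot_gt0 // (le_trans (ler_norm _)) // dot_mulmx_abs.
Qed.

Lemma rayleigh_le A x : dot (x *m A) x <= sup (rayleigh A) * dot x x.
Proof.
have [->|x0] := eqVneq x 0; first by rewrite mul0mx !dot0l mulr0.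
rewrite -ler_pdivrMr ?dot_gt0 //; apply: sup_upper_bound; first exact: has_sup_rayleigh.
by exists x.
Qed.

(** Attainment without compactness. If [B = q%:M - A] were invertible, [|x|^2] would be at most a
    constant times [|x B|^2], which by semidefiniteness is at most a constant times the form [B] at
    [x]. The Rayleigh quotient would then stay below [q] by a fixed amount. *)
Lemma eigenvalue_rayleigh A : A^T = A -> eigenvalue A (sup (rayleigh A)).
Proof.
move=> sA; set q := sup (rayleigh A); pose B := q%:M - A.
have sB : B^T = B by rewrite /B linearB /= tr_scalar_mx sA.
have BE x : dot (x *m B) x = q * dot x x - dot (x *m A) x.
  by rewrite /B mulmxBr dotBl mul_mx_scalar dotZl.
have psd x : 0 <= dot (x *m B) x by rewrite BE subr_ge0 rayleigh_le.
have [uB|nuB] := boolP (B \in unitmx); last first.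
  move: nuB; rewrite -row_free_unit -kermx_eq0 => /rowV0Pn[v /sub_kermxP vB v0].
  apply/eigenvalueP; exists v => //; move/eqP: vB; rewrite /B mulmxBr subr_eq0 => /eqP <-.
  by rewrite mul_mx_scalar.
pose F := frob (invmx B); pose K := frob B + 1.
have K1 : 0 < K by rewrite ltr_wpDl ?frob_ge0.
have F0 : 0 <= F by exact: frob_ge0.
(* Cauchy-Schwarz for the form [B], applied to [x] and [x *m B]. *)
have xB x : dot (x *m B) (x *m B) <= K * dot (x *m B) x.
  have := psd_cauchy_schwarz x (x *m B) sB psd.
  have := dot_mulmx_abs (x *m B) B; have := ler_norm (dot (x *m B *m B) (x *m B)).
  set u := dot (x *m B) (x *m B); set v := dot (x *m B) x; set w := dot (x *m B *m B) _.
  rewrite -/K => h1 h2 h3; have u0 : 0 <= u by exact: dot_ge0.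
  have v0 : 0 <= v by exact: psd.
  have [->|un0] := eqVneq u 0; first by rewrite mulr_ge0 // ltW.
  have u1 : 0 < u by rewrite lt_def un0.
  have : u * u <= u * (K * v).
    rewrite -expr2 (_ : u * (K * v) = v * (K * u)); last by ring.
    by apply: (le_trans h3); rewrite ler_wpM2l // (le_trans h1 h2).
  by rewrite ler_pM2l.
have xx x : dot x x <= F * K * dot (x *m B) x.
  have -> : dot x x = dot (x *m B *m invmx B) (x *m B *m invmx B) by rewrite mulmxK.
  by apply: (le_trans (dot_mulmx_le _ _)); rewrite -mulrA ler_wpM2l.
have G0 : 0 < F * K + 1 by rewrite ltr_wpDl // mulr_ge0 // ltW.
have : q <= q - (F * K + 1)^-1.
  apply: ge_sup; first by case: (has_sup_rayleigh A).
  move=> _ [x x0 ->]; rewrite ler_pdivrMr ?dot_gt0 // mulrBl.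
  have : (F * K + 1)^-1 * dot x x <= dot (x *m B) x.
    rewrite ler_pdivrMl //; apply: (le_trans (xx x)).
    by rewrite ler_wpM2r ?psd // lerDl.
  by rewrite BE; lra.
have : 0 < (F * K + 1)^-1 by rewrite invr_gt0.
lra.
Qed.

Lemma lambda1E A : A^T = A -> lambda1 A = sup (rayleigh A).
Proof.
move=> sA; have eq := eigenvalue_rayleigh sA.
have ub a : eigenvalue A a -> a <= sup (rayleigh A).
  move=> /eigenvalueP[v vA v0].
  have := rayleigh_le A v; rewrite vA dotZl ler_pM2r //; exact: dot_gt0.
apply/le_anti/andP; split.
  by apply: ge_sup => [|a]; [exists (sup (rayleigh A))|exact: ub].
apply: sup_upper_bound => //; split; first by exists (sup (rayleigh A)).
by exists (sup (rayleigh A)) => a; exact: ub.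
Qed.

Lemma lambda1_ge A x : A^T = A -> dot (x *m A) x <= lambda1 A * dot x x.
Proof. by move=> sA; rewrite lambda1E // rayleigh_le. Qed.

Lemma lambda1_attained A : A^T = A ->
  exists2 x, x != 0 & dot (x *m A) x = lambda1 A * dot x x.
Proof.
move=> sA; have /eigenvalueP[v vA v0] := eigenvalue_rayleigh sA.
by exists v => //; rewrite vA dotZl lambda1E.
Qed.

(** Rational vectors are countable, so this writes [c < lambda1 A] as a countable union of
    conditions on the entries: the source of measurability. The strict inequality at a maximiser
    survives a small move to a rational vector. *)
Lemma lambda1_gtP A (c : R) : A^T = A ->
  c < lambda1 A <-> exists r : 'rV[rat]_n.+1,
    let y := map_mx ratr r in c * dot y y < dot (y *m A) y.
Proof.
move=> sA; split=> [cl|[r /= h]]; last first.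
  rewrite ltNge; apply/negP => hc.
  have := lt_le_trans h (lambda1_ge (map_mx ratr r) sA).
  by rewrite ltNge ler_wpM2r ?dot_ge0.
have [x x0 xA] := lambda1_attained sA.
pose B := A - c%:M; pose u := x *m B; pose K := frob B + 1; pose f0 := dot u x.
have sB : B^T = B by rewrite /B linearB /= tr_scalar_mx sA.
have BE y : dot (y *m B) y = dot (y *m A) y - c * dot y y.
  by rewrite /B mulmxBr dotBl mul_mx_scalar dotZl.
have f0_gt0 : 0 < f0 by rewrite /f0 /u BE xA -mulrBl mulr_gt0 ?dot_gt0 // subr_gt0.
have N1 : 0 < dot u u + 1 by rewrite ltr_wpDl ?dot_ge0.
(* At [x + h] the form [B] equals [f0 + 2 <u, h> + <h B, h>]. The cross term costs at most
   [eta |u|^2 + |h|^2 / eta]; [eta] makes the first part at most [f0 / 4], and [delta] makes all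
   multiples of [|h|^2] together at most [f0 / 2]. *)
pose eta := f0 / (4 * (dot u u + 1)).
have eta0 : 0 < eta by rewrite divr_gt0 // mulr_gt0.
have K0 : 0 < K by rewrite ltr_wpDl ?frob_ge0.
pose L := (eta^-1 + K) * n.+1%:R.
have L0 : 0 < L by rewrite mulr_gt0 // addr_gt0 // invr_gt0.
pose delta := Num.min 1 (f0 / (2 * L)).
have d0 : 0 < delta by rewrite lt_min ltr01 divr_gt0 // mulr_gt0.
have dL : L * delta ^+ 2 <= f0 / 2.
  apply: (@le_trans _ _ (L * delta)).
    by rewrite ler_wpM2l ?(ltW L0) // expr2 ler_piMl ?(ltW d0) // ge_min lexx.
  rewrite -ler_pdivlMl //; apply: (@le_trans _ _ (f0 / (2 * L))).
    by rewrite ge_min lexx orbT.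
  by rewrite le_eqVlt; apply/orP; left; apply/eqP; field; rewrite gt_eqF.
have /fin_all_exists[r hr] i : exists q : rat, x 0 i < ratr q < x 0 i + delta.
  have [|q] := @rat_in_itvoo R (x 0 i) (x 0 i + delta); first by rewrite ltrDl.
  by rewrite in_itv /= => hq; exists q.
exists (\row_i r i) => /=; set y := map_mx _ _.
pose h := y - x; have yE : y = x + h by rewrite /h subrKC.
have Nh : dot h h <= n.+1%:R * delta ^+ 2.
  rewrite dotE; apply: (@le_trans _ _ (\sum_(i < n.+1) delta ^+ 2)); last first.
    by rewrite sumr_const card_ord mulr_natl.
  apply: ler_sum => i _; rewrite -expr2 !mxE; apply: lerXn2r; rewrite ?nnegrE ?(ltW d0) //.
    by have /andP[/ltW] := hr i; rewrite subr_ge0.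
  by have /andP[_ /ltW] := hr i; rewrite lerBlDl.
rewrite -subr_gt0 -BE yE; clearbody h; rewrite mulmxDl !(dotDl, dotDr).
have -> : dot (h *m B) x = dot u h by rewrite dot_mulmx sB dotC.
have h1 : - (eta * dot u u + eta^-1 * dot h h) <= 2 * dot u h.
  have := dot_ge0 (eta *: u + h); rewrite !(dotDl, dotDr, dotZl, dotZr) (dotC h u) => h1.
  rewrite -subr_ge0; have -> : 2 * dot u h - - (eta * dot u u + eta^-1 * dot h h) =
    eta^-1 * (eta * (eta * dot u u) + eta * dot u h + (eta * dot u h + dot h h)).
    by field; rewrite gt_eqF.
  apply: mulr_ge0; first by rewrite invr_ge0 ltW.
  by apply: le_trans h1 _; rewrite le_eqVlt; apply/orP; left; apply/eqP; ring.
have h2 : - (K * dot h h) <= dot (h *m B) h.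
  rewrite lerNl; apply: le_trans (dot_mulmx_abs h B).
  by rewrite -normrN ler_norm.
have h3 : eta * dot u u <= f0 / 4.
  rewrite /eta mulrAC ler_pdivrMr ?mulr_gt0 //.
  have -> : f0 / 4 * (4 * (dot u u + 1)) = f0 * (dot u u + 1) by field.
  by rewrite ler_pM2l // lerDl.
have h4 : (eta^-1 + K) * dot h h <= f0 / 2.
  apply: le_trans dL; rewrite /L -mulrA ler_wpM2l // addr_ge0 ?invr_ge0 ?(ltW K0) //.
  exact: ltW.
rewrite mulrDl in h4; rewrite -/u -/f0; lra.
Qed.

Lemma trmx_exp A m : A^T = A -> (A ^+ m)^T = A ^+ m.
Proof.
move=> sA; elim: m => [|m IH]; first by rewrite expr0 trmx1.
by rewrite exprS -mulmxE trmx_mul IH sA mulmxE -exprSr exprS.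
Qed.

(** Replaces the bound of the norm by the trace of an even power, without diagonalising:
    [|x Z|^2 = <x Z^2, x> <= |x Z^2| |x|], iterated. Repeated squaring is why only powers of two
    occur as exponents. *)
Lemma mulmx_pow_norm A x k : A^T = A ->
  dot (x *m A) (x *m A) ^+ (2 ^ k) <= frob (A ^+ (2 ^ k)) * dot x x ^+ (2 ^ k).
Proof.
move=> sA; have [->|x0] := eqVneq x 0.
  by rewrite mul0mx !dot0l !expr0n gtn_eqF ?expn_gt0 // mulr0.
have N0 := dot_gt0 x0.
suff h : dot (x *m A) (x *m A) ^+ (2 ^ k) <=
    dot (x *m A ^+ (2 ^ k)) (x *m A ^+ (2 ^ k)) * dot x x ^+ (2 ^ k).-1.
  apply: (le_trans h).
  have -> : dot x x ^+ (2 ^ k) = dot x x * dot x x ^+ (2 ^ k).-1.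
    by rewrite -exprS prednK ?expn_gt0.
  rewrite mulrA.
  by rewrite ler_wpM2r ?exprn_ge0 ?dot_ge0 // dot_mulmx_le.
elim: k => [|k IH]; first by rewrite expr1 expr0 mulr1.
rewrite expnS mulnC exprM.
have h1 : 0 <= dot (x *m A) (x *m A) ^+ (2 ^ k) by rewrite exprn_ge0 ?dot_ge0.
apply: (@le_trans _ _ ((dot (x *m A ^+ (2 ^ k)) (x *m A ^+ (2 ^ k)) * dot x x ^+ (2 ^ k).-1) ^+ 2)).
  by apply: lerXn2r IH; rewrite nnegrE // mulr_ge0 ?exprn_ge0 ?dot_ge0.
set Z := A ^+ (2 ^ k); have sZ : Z^T = Z by exact: trmx_exp.
have -> : A ^+ (2 ^ k * 2) = Z *m Z by rewrite exprM expr2 mulmxE.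
rewrite exprMn.
have -> : (2 ^ k * 2).-1 = (1 + (2 ^ k).-1 * 2)%N.
  by case: (2 ^ k)%N (expn_gt0 2 k) => // m _; rewrite mulSn.
rewrite exprD expr1 -exprM [leRHS]mulrA ler_wpM2r ?exprn_ge0 ?dot_ge0 //.
rewrite dot_mulmx sZ dotC; apply: (le_trans (dot_cauchy_schwarz _ _)).
by rewrite mulmxA.
Qed.
End Lambda1.

(** * Perturbation of a rank-one matrix *)

Section RankOne.
Variables (R : realType) (n : nat).
Variables (W : 'M[R]_n.+1) (e : 'rV[R]_n.+1) (lam K : R).
Hypotheses (sW : W^T = W) (e1 : dot e e = 1) (lam_gt0 : 0 < lam) (K_gt0 : 0 < K).
Hypothesis W_le : forall x, dot (x *m W) (x *m W) <= K ^+ 2 * dot x x.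

Let A := W + lam *: (e^T *m e).
(* Locked: otherwise rewriting and [field] see through them. *)
Let a := locked (dot (e *m W) e).
Let b := locked (e *m W - a *: e).
Let v := locked (dot (e *m W) (e *m W) - a ^+ 2).

Let aE : a = dot (e *m W) e. Proof. by rewrite /a -lock. Qed.
Let bE : b = e *m W - a *: e. Proof. by rewrite /b -lock. Qed.
Let vE : v = dot (e *m W) (e *m W) - a ^+ 2. Proof. by rewrite /v -lock. Qed.

Lemma rank_one_sym : A^T = A.
Proof. by rewrite /A linearD linearZ /= trmx_mul trmxK sW. Qed.

Lemma dot_rank_one x : dot (x *m A) x = dot (x *m W) x + lam * dot x e ^+ 2.
Proof.
rewrite /A mulmxDr dotDl -scalemxAr dotZl; congr (_ + _ * _).
rewrite mulmxA [x *m e^T]mx11_scalar mul_scalar_mx dotZl -/(dot x e).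
by rewrite (dotC e) expr2.
Qed.

Lemma dot_W_abs x : `|dot (x *m W) x| <= K * dot x x.
Proof.
apply: sqr_le_sqr_abs; first by rewrite mulr_ge0 ?dot_ge0 // ltW.
apply: (le_trans (dot_cauchy_schwarz _ _)).
by rewrite exprMn [in leRHS]expr2 [in leRHS]mulrA -expr2 ler_wpM2r ?dot_ge0.
Qed.

Let dot_eb : dot e b = 0.
Proof. by rewrite bE dotBr dotZr e1 mulr1 dotC aE subrr. Qed.

Let dot_bb : dot b b = v.
Proof.
by rewrite bE dotBl !(dotBr, dotZr, dotZl) e1 (dotC e) -aE vE; ring.
Qed.

Let dot_eWx x : dot (e *m W) x = a * dot e x + dot b x.
Proof. by rewrite bE dotBl dotZl subrKC. Qed.

Let v_ge0 : 0 <= v. Proof. by rewrite -dot_bb dot_ge0. Qed.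

Let a_abs : `|a| <= K.
Proof. by have := dot_W_abs e; rewrite e1 mulr1 -aE. Qed.

Let v_le : v <= K ^+ 2.
Proof.
have := W_le e; rewrite e1 mulr1; have := sqr_ge0 a; rewrite vE; lra.
Qed.

Lemma lambda1_rank_one_le_small : `|lambda1 A - lam - a| <= 2 * K.
Proof.
have := lambda1_ge e rank_one_sym; rewrite dot_rank_one e1 expr1n !mulr1 -aE => h1.
have [x x0 xA] := lambda1_attained rank_one_sym.
have h2 : lambda1 A <= lam + K.
  rewrite -(ler_pM2r (dot_gt0 x0)) -xA dot_rank_one mulrDl addrC lerD //.
    rewrite ler_wpM2l ?(ltW lam_gt0) // (le_trans (dot_cauchy_schwarz _ _)) //.
    by rewrite e1 mulr1.
  exact: le_trans (ler_norm _) (dot_W_abs x).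
move: a_abs; rewrite !ler_norml => /andP[h3 h4]; apply/andP; split; lra.
Qed.

Lemma lambda1_rank_one_lower : 4 * K < lam ->
  lam + a + v / lam - 3 * K ^+ 3 / lam ^+ 2 <= lambda1 A.
Proof.
move=> lK; have l0 := lt0r_neq0 lam_gt0.
pose x := e + lam^-1 *: b.
have xx : dot x x = 1 + v / lam ^+ 2.
  rewrite /x !(dotDl, dotDr, dotZl, dotZr) (dotC b) dot_eb dot_bb e1; field.
  exact: l0.
have xe : dot x e = 1.
  by rewrite /x dotDl dotZl (dotC b) dot_eb e1 mulr0 addr0.
have xA : dot (x *m A) x = lam + a + 2 * v / lam + dot (b *m W) b / lam ^+ 2.
  rewrite dot_rank_one xe {1 2}/x mulmxDl -scalemxAl !(dotDl, dotDr, dotZl, dotZr).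
  have -> : dot (b *m W) e = v.
    by rewrite dot_mulmx sW dotC dot_eWx dot_eb mulr0 add0r dot_bb.
  rewrite !dot_eWx dot_eb dot_bb e1 (dotC b) dot_eb; field.
  exact: l0.
have := lambda1_ge x rank_one_sym; rewrite xA xx.
set t := lambda1 A => h.
have s0 : 0 < 1 + v / lam ^+ 2 by rewrite ltr_wpDr // divr_ge0 ?sqr_ge0.
rewrite -(ler_pM2r s0); apply: le_trans h.
have bWb := dot_W_abs b; rewrite dot_bb ler_norml in bWb.
have /andP[w1 _] := bWb.
have a_ub := le_trans (ler_norm a) a_abs.
set w := dot (b *m W) b in w1 *.
rewrite -subr_ge0.
have -> : lam + a + 2 * v / lam + w / lam ^+ 2 -
  (lam + a + v / lam - 3 * K ^+ 3 / lam ^+ 2) * (1 + v / lam ^+ 2) =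
  (w - a * v - v ^+ 2 / lam + 3 * K ^+ 3 * (1 + v / lam ^+ 2)) / lam ^+ 2.
  by field; exact: l0.
rewrite divr_ge0 ?sqr_ge0 //.
(* The errors from [w], [a v] and [v^2 / lam] are at most [K^3] each, whence the constant 3. *)
have h1 : K * v <= K ^+ 3 by rewrite exprS ler_wpM2l // ltW.
have h2 : a * v <= K * v by rewrite ler_wpM2r.
have h3 : v ^+ 2 / lam <= K ^+ 3.
  rewrite ler_pdivrMr // expr2; apply: (@le_trans _ _ (K ^+ 2 * K ^+ 2)).
    by rewrite ler_pM.
  have -> : K ^+ 3 * lam = K ^+ 2 * (K * lam) by ring.
  by rewrite ler_wpM2l ?sqr_ge0 // [leLHS]expr2 ler_pM2l //; move: lK K_gt0; lra.
have h4 : K ^+ 3 <= K ^+ 3 * (1 + v / lam ^+ 2).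
  by rewrite ler_peMr ?exprn_ge0 ?lerDl ?divr_ge0 ?sqr_ge0 // ltW.
lra.
Qed.

Lemma lambda1_rank_one_upper : 4 * K < lam ->
  lambda1 A <= lam + a + v / lam + 4 * K ^+ 3 / lam ^+ 2.
Proof.
move=> lK; have l0 := lt0r_neq0 lam_gt0.
set c := 4 * K ^+ 3 / lam ^+ 2.
have c0 : 0 < c by rewrite divr_gt0 ?mulr_gt0 ?exprn_gt0.
(* The claimed excess over [lam + a]. On the span of [e] and [y] the form is dominated by a 2 x 2
   matrix with diagonal [lam + a], [K] and off-diagonal entry the square root of [v]; its top
   eigenvalue is at most [lam + a + s] once [v <= s * (lam + a + s - K)]. *)
pose s := v / lam + c.
have s0 : 0 < s by rewrite ltr_wpDl // divr_ge0 // ltW.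
have [x x0 xA] := lambda1_attained rank_one_sym.
pose al := dot x e; pose y := x - al *: e.
have xE : x = al *: e + y by rewrite /y subrKC.
have ye : dot y e = 0 by rewrite /y dotBl dotZl e1 mulr1 subrr.
clearbody y.
rewrite -(ler_pM2r (dot_gt0 x0)) -xA dot_rank_one -/al xE.
clearbody al.
rewrite mulmxDl -scalemxAl !(dotDl, dotDr, dotZl, dotZr) e1 (dotC e y) ye.
have -> : dot (y *m W) e = dot b y.
  by rewrite dot_mulmx sW dotC dot_eWx (dotC e) ye mulr0 add0r.
rewrite !dot_eWx e1 (dotC e y) ye (dotC b e) dot_eb.
set p := dot b y; set N := dot y y.
have N0 : 0 <= N by exact: dot_ge0.
have p2 : p ^+ 2 <= v * N by rewrite -dot_bb dot_cauchy_schwarz.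
have h1 : 2 * al * p <= al ^+ 2 * s + v * N / s.
  apply: (@le_trans _ _ (al ^+ 2 * s + p ^+ 2 / s)); last first.
    by rewrite lerD2l ler_wpM2r // invr_ge0 ltW.
  rewrite -subr_ge0.
  have -> : al ^+ 2 * s + p ^+ 2 / s - 2 * al * p = (al * s - p) ^+ 2 / s.
    by field; rewrite gt_eqF.
  by rewrite divr_ge0 ?sqr_ge0 // ltW.
have h2 : dot (y *m W) y <= K * N by exact: le_trans (ler_norm _) (dot_W_abs y).
have a_lb : - K <= a by move: a_abs; rewrite ler_norml => /andP[].
(* After [a >= - K], the part [v / lam] of [s] falls short by [2 K v / lam]; [c] is chosen to make
   up for this when [lam > 4 K]. *)
have h3 : v <= s * (lam + a + s - K).
  apply: (@le_trans _ _ (s * (lam - 2 * K))); last first.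
    by rewrite ler_wpM2l ?(ltW s0) //; lra.
  rewrite -subr_ge0.
  have -> : s * (lam - 2 * K) - v = (4 * K ^+ 3 * (lam - 2 * K) - 2 * K * v * lam) / lam ^+ 2.
    by rewrite /s /c; field; exact: l0.
  rewrite divr_ge0 ?sqr_ge0 // subr_ge0.
  apply: (@le_trans _ _ (2 * K ^+ 3 * lam)).
    by rewrite ler_wpM2r ?(ltW lam_gt0) // -mulrA ler_wpM2l // exprS ler_wpM2l // ltW.
  rewrite -subr_ge0.
  have -> : 4 * K ^+ 3 * (lam - 2 * K) - 2 * K ^+ 3 * lam = 2 * K ^+ 3 * (lam - 4 * K) by ring.
  by rewrite mulr_ge0 ?mulr_ge0 ?exprn_ge0 ?(ltW K_gt0) // subr_ge0 ltW.
have h4 : v * N / s + K * N <= (lam + a + s) * N.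
  have : v / s <= lam + a + s - K by rewrite ler_pdivrMr // mulrC.
  by move=> /(ler_wpM2r N0); rewrite mulrBl lerBrDr mulrAC.
rewrite -[lam + a + v / lam + c]addrA -/s.
move: h1 h2 h4; move: (v * N / s) (dot (y *m W) y) => q w h1 h2 h4.
apply: (@le_trans _ _ (al ^+ 2 * (lam + a) + (al ^+ 2 * s + (q + K * N)))).
  have -> : al * (al * (a * 1 + 0) + (a * 0 + p)) + (al * p + w) + lam * al ^+ 2 =
    al ^+ 2 * (lam + a) + (2 * al * p + w) by ring.
  by rewrite lerD2l addrA lerD.
have -> : (lam + a + s) * (al * (al * 1 + 0) + (al * 0 + N)) =
  al ^+ 2 * (lam + a) + (al ^+ 2 * s + (lam + a + s) * N) by ring.
by rewrite !lerD2l.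
Qed.

(** For [lam <= 4 K] the trivial bound [2 K + K^2 / lam] is enough: multiplied by [lam^2] it is at
    most [32 K^3 + 4 K^3], the origin of 36. Thus the estimate is uniform down to small [lam]. *)
Lemma lambda1_rank_one :
  `|lambda1 (W + lam *: (e^T *m e)) - lam - 1 / lam - dot (e *m W) e -
    (dot (e *m W) (e *m W) - dot (e *m W) e ^+ 2 - 1) / lam| <= 36 * K ^+ 3 / lam ^+ 2.
Proof.
rewrite -aE -vE -/A.
have l0 := lt0r_neq0 lam_gt0.
have -> : lambda1 A - lam - 1 / lam - a - (v - 1) / lam = lambda1 A - lam - a - v / lam.
  by field; exact: l0.
have [lK|lK] := ltP (4 * K) lam.
  have := lambda1_rank_one_lower lK; have := lambda1_rank_one_upper lK.
  have : 0 <= K ^+ 3 / lam ^+ 2 by rewrite divr_ge0 ?exprn_ge0 // ltW.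
  rewrite -!mulrA; set q := K ^+ 3 / lam ^+ 2 => q0 h1 h2.
  by rewrite ler_norml; apply/andP; split; lra.
apply: (le_trans (ler_normB _ _)).
have h1 : v / lam <= K ^+ 2 / lam by rewrite ler_wpM2r // invr_ge0 ltW.
rewrite (ger0_norm (_ : 0 <= v / lam)); last by rewrite divr_ge0 // ltW.
apply: le_trans (lerD lambda1_rank_one_le_small h1) _.
rewrite ler_pdivlMr ?exprn_gt0 //.
have -> : (2 * K + K ^+ 2 / lam) * lam ^+ 2 = 2 * K * lam ^+ 2 + K ^+ 2 * lam.
  by field; exact: l0.
have h2 : lam ^+ 2 <= (4 * K) ^+ 2 by rewrite lerXn2r // nnegrE ?ltW // mulr_gt0.
have h3 : 2 * K * lam ^+ 2 <= 2 * K * (4 * K) ^+ 2.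
  by rewrite ler_wpM2l // mulr_ge0 // ltW.
have h4 : K ^+ 2 * lam <= K ^+ 2 * (4 * K) by rewrite ler_wpM2l // sqr_ge0.
apply: le_trans (lerD h3 h4) _.
by rewrite le_eqVlt; apply/orP; left; apply/eqP; ring.
Qed.

End RankOne.

(** * Moments of Gaussian vectors *)

Section Mgf.
Variable R : realType.
Local Notation mu := (@lebesgue_measure R).

(** The Radon-Nikodym derivative and [normal_pdf] have the same integral over every measurable set,
    hence agree almost everywhere. *)
Lemma ge0_integral_normal_prob (m s : R) (f : R -> R) :
  measurable_fun setT f -> (forall x, 0 <= f x) ->
  (\int[normal_prob m s]_x (f x)%:E = \int[mu]_x (f x * normal_pdf m s x)%:E)%E.
Proof.
move=> mf f0.
have dom := normal_prob_dominates m s.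
rewrite -(Radon_Nikodym_SigmaFinite.change_of_variables dom) //=; last first.
  exact/measurable_EFinP.
have iRN := Radon_Nikodym_SigmaFinite.f_integrable dom.
have mRN := measurable_int _ iRN.
have mpdf : measurable_fun setT (EFin \o normal_pdf m s).
  by apply/measurable_EFinP; exact: measurable_normal_pdf.
under [RHS]eq_integral do rewrite EFinM.
apply: ae_eq_integral => //.
- by apply: emeasurable_funM => //; exact/measurable_EFinP.
- by apply: emeasurable_funM => //; exact/measurable_EFinP.
- apply: ae_eqe_mul2l; apply: integral_ae_eq => //= A _ mA.
  by rewrite -(Radon_Nikodym_SigmaFinite.f_integral dom).
Qed.

Lemma mgf_normal (m s t : R) : s != 0 ->
  (\int[normal_prob m s]_x (expR (t * x))%:E = (expR (t * m + t ^+ 2 * s ^+ 2 / 2))%:E)%E.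
Proof.
move=> s0; rewrite ge0_integral_normal_prob; last 2 first.
- by apply: measurableT_comp => //; apply: measurable_funM.
- by move=> x; exact: expR_ge0.
(* Completing the square: the exponential tilt shifts the mean by [t * s ^+ 2]. *)
have e x : expR (t * x) * normal_pdf m s x =
    expR (t * m + t ^+ 2 * s ^+ 2 / 2) * normal_pdf (m + t * s ^+ 2) s x.
  rewrite !normal_pdfE // mulrCA [RHS]mulrCA /normal_fun -!expRD.
  by congr (_ * expR _); field.
under eq_integral do rewrite e EFinM.
rewrite integralZl //; last exact: integrable_normal_pdf.
by rewrite integral_normal_pdf mule1.
Qed.

(** One formula covers both cases, the point mass being [s = 0]. *)
Lemma mgf_gaussian_law d (T : measurableType d) (P : probability T R)
    (Y : {RV P >-> R}) (m s : R) :
  (forall A : set R, measurable A -> P [set w | A (Y w)] = gaussian_law m s A) ->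
  forall t, (\int[P]_w (expR (t * Y w))%:E =
             (expR (t * m + t ^+ 2 * s ^+ 2 / 2))%:E)%E.
Proof.
move=> law t.
have me : measurable_fun setT (fun x : R => expR (t * x)).
  by apply: measurableT_comp => //; apply: measurable_funM.
have mY : measurable_fun setT (Y : T -> measurableTypeR R).
  by move=> mT A mA; exact: (measurable_funPT Y).
have -> : (\int[P]_w (expR (t * Y w))%:E =
    \int[pushforward P (Y : T -> measurableTypeR R)]_y (expR (t * y))%:E)%E.
  by rewrite ge0_integral_pushforward //; exact/measurable_EFinP.
move: law; rewrite /gaussian_law; case: eqP => [-> law|/eqP s0 law].
  rewrite (@eq_measure_integral _ _ _ _ (\d_ (m : measurableTypeR R))) => [|A mA _];
    last exact: law.
  rewrite integral_dirac //; first by rewrite diracT mul1e expr0n mulr0 mul0r addr0.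
  exact/measurable_EFinP.
rewrite -mgf_normal //.
by apply: eq_measure_integral => A mA _; exact: law.
Qed.

End Mgf.

(** * First-order expansions at zero *)

Section Tangent.
Variable R : realType.

(** A derivative at 0 with an explicit quadratic remainder. This form comes directly from dominating
    an integrand, so no limit has to be exchanged with an integral. *)
Definition tangent (g : R -> R) (l : R) :=
  exists C, forall t, `|t| <= 1 -> `|g t - g 0 - t * l| <= C * t ^+ 2.

Lemma eq_tangent g g' l : g =1 g' -> tangent g l -> tangent g' l.
Proof. by move=> e [C h]; exists C => t t1; rewrite -!e h. Qed.

(** The way identities between moments are proved below: the same function of [t] is expanded in two
    ways. *)
Lemma tangent_unique g l l' : tangent g l -> tangent g l' -> l = l'.
Proof.
move=> [C h] [C' h']; apply/eqP; rewrite -subr_eq0 -normr_eq0; apply/eqP/le_anti.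
rewrite normr_ge0 andbT; apply/ler_addgt0Pr => e e0; rewrite add0r.
pose K := `|C| + `|C'| + 1.
have K0 : 0 < K by rewrite /K ltr_wpDl // addr_ge0.
pose t := Num.min 1 (e / K).
have t0 : 0 < t by rewrite lt_min ltr01 divr_gt0.
have t1 : `|t| <= 1 by rewrite gtr0_norm // ge_min lexx.
have tK : t * K <= e by rewrite -ler_pdivlMr // ge_min lexx orbT.
have := ler_normB (g t - g 0 - t * l') (g t - g 0 - t * l).
have -> : g t - g 0 - t * l' - (g t - g 0 - t * l) = t * (l - l') by ring.
rewrite normrM (gtr0_norm t0) => hh.
have h2 : t * `|l - l'| <= t * e.
  apply: (le_trans hh); apply: le_trans (lerD (h' _ t1) (h _ t1)) _.
  apply: (@le_trans _ _ (t * (t * K))); last by rewrite ler_pM2l.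
  rewrite -mulrDl mulrA -expr2 mulrC ler_wpM2l ?sqr_ge0 // /K.
  have := ler_norm C; have := ler_norm C'; lra.
by rewrite ler_pM2l in h2.
Qed.

Lemma tangent_affine a b : tangent (fun t => a + t * b) b.
Proof.
exists 0 => t _; rewrite (_ : _ - _ - _ = 0) ?normr0 ?mul0r //; ring.
Qed.

Lemma tangentD g g' l l' :
  tangent g l -> tangent g' l' -> tangent (fun t => g t + g' t) (l + l').
Proof.
move=> [C h] [C' h']; exists (C + C') => t t1; rewrite mulrDl.
rewrite (_ : _ - _ - _ = (g t - g 0 - t * l) + (g' t - g' 0 - t * l')); last by ring.
by apply: le_trans (ler_normD _ _) (lerD (h _ t1) (h' _ t1)).
Qed.

Lemma tangentM g g' l l' : tangent g l -> tangent g' l' ->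
  tangent (fun t => g t * g' t) (l * g' 0 + g 0 * l').
Proof.
move=> [C h] [C' h'].
exists (`|C| * (`|C'| + `|l'| + `|g' 0|) + `|l| * (`|C'| + `|l'|) + `|g 0| * `|C'|) => t t1.
have t2 : 0 <= t ^+ 2 by rewrite sqr_ge0.
have t21 : t ^+ 2 <= 1 by rewrite -real_normK ?num_real // exprn_ile1.
have h1 := le_trans (h _ t1) (ler_wpM2r t2 (ler_norm C)).
have h1' := le_trans (h' _ t1) (ler_wpM2r t2 (ler_norm C')).
have g'b : `|g' t| <= `|C'| + `|l'| + `|g' 0|.
  have -> : g' t = (g' t - g' 0 - t * l') + t * l' + g' 0 by ring.
  apply: (le_trans (ler_normD _ _)); rewrite lerD2r.
  apply: (le_trans (ler_normD _ _)); apply: lerD.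
    by apply: (le_trans h1'); rewrite ler_piMr.
  by rewrite normrM ler_piMl.
have g'c : `|g' t - g' 0| <= (`|C'| + `|l'|) * `|t|.
  have -> : g' t - g' 0 = (g' t - g' 0 - t * l') + t * l' by ring.
  apply: (le_trans (ler_normD _ _)); rewrite mulrDl normrM lerD //; last by rewrite mulrC.
  apply: (le_trans h1'); rewrite ler_wpM2l // -real_normK ?num_real // expr2.
  by rewrite ler_piMl.
have -> : g t * g' t - g 0 * g' 0 - t * (l * g' 0 + g 0 * l') =
  (g t - g 0 - t * l) * g' t + t * l * (g' t - g' 0) + g 0 * (g' t - g' 0 - t * l') by ring.
rewrite [leRHS]mulrDl [X in _ <= X + _]mulrDl.
apply: (le_trans (ler_normD _ _)); apply: lerD.
  apply: (le_trans (ler_normD _ _)); apply: lerD.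
    rewrite normrM [leRHS]mulrAC; exact: ler_pM.
  rewrite !normrM -mulrA [leRHS](_ : _ = `|l| * (`|t| * ((`|C'| + `|l'|) * `|t|))).
    by rewrite mulrCA !ler_wpM2l.
  by rewrite -real_normK ?num_real //; ring.
by rewrite normrM -mulrA ler_wpM2l.
Qed.

Lemma tangent_scale c g l : tangent g l -> tangent (fun t => c * g t) (c * l).
Proof.
move=> h; have := tangentM (tangent_affine c 0) h; rewrite mul0r add0r mul0r addr0.
by apply: eq_tangent => t; rewrite mulr0 addr0.
Qed.

Lemma tangent_removals (A : Type) (s : seq A) (psi : R -> A -> seq A -> R) l :
  (forall b r, tangent (fun t => psi t b r) (l b r)) ->
  tangent (fun t => removals s (psi t)) (removals s l).
Proof.
elim: s psi l => [|b s IH] psi l h /=.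
  by apply: (@eq_tangent (fun t => 0 + t * 0)) (tangent_affine _ _) => t; rewrite mulr0 addr0.
apply: tangentD => //; exact: (IH (fun t g r => psi t g (b :: r))).
Qed.

Lemma expR_taylor1 (x : R) : `|expR x - 1 - x| <= x ^+ 2 * expR `|x|.
Proof.
have h1 : 0 <= expR x - 1 - x by rewrite subr_ge0 lerBrDl expR_ge1Dx.
rewrite ger0_norm //.
have h2 : expR x - 1 <= x * expR x.
  have := expR_ge1Dx (- x); rewrite -(ler_pM2r (expR_gt0 x)) -expRD addNr expR0.
    by rewrite mulrDl mul1r mulNr; lra.
have h3 : expR x - 1 - x <= x * (expR x - 1) by lra.
apply: (le_trans h3); case: (lerP 0 x) => x0.
  by rewrite ger0_norm // expr2 -mulrA ler_wpM2l.
have : 1 - expR x <= - x by have := expR_ge1Dx x; lra.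
have h4 : 1 <= expR (- x) by have := expR_ge1Dx (- x); lra.
rewrite ltr0_norm // => h5.
apply: (@le_trans _ _ (x ^+ 2)); last by rewrite ler_peMr ?sqr_ge0.
by rewrite expr2; apply: ler_wnM2l; lra.
Qed.

Lemma tangent_expR a b : tangent (fun t => expR (t * a + t ^+ 2 * b)) a.
Proof.
exists ((`|a| + `|b|) ^+ 2 * expR (`|a| + `|b|) + `|b|) => t t1.
rewrite mul0r expr0n mul0r addr0 expR0; set x := t * a + t ^+ 2 * b.
have xb : `|x| <= (`|a| + `|b|) * `|t|.
  rewrite [leRHS]mulrDl /x; apply: (le_trans (ler_normD _ _)).
  rewrite !normrM; apply: lerD; first by rewrite mulrC.
  by rewrite mulrC ler_wpM2l // ler_piMl.
have -> : expR x - 1 - t * a = (expR x - 1 - x) + t ^+ 2 * b by rewrite /x; ring.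
apply: (le_trans (ler_normD _ _)); rewrite [leRHS]mulrDl lerD //; last first.
  by rewrite normrM mulrC normrX real_normK ?num_real.
apply: (le_trans (expR_taylor1 x)).
rewrite -[leRHS]mulrAC; apply: ler_pM; rewrite ?sqr_ge0 ?expR_ge0 //.
  rewrite -(real_normK (num_real x)) -(real_normK (num_real t)) -exprMn.
  by apply: lerXn2r => //; rewrite nnegrE ?mulr_ge0 ?addr_ge0.
by rewrite ler_expR (le_trans xb) // ler_piMr // addr_ge0.
Qed.

End Tangent.

(** * Exponentially dominated functions and their means *)

Section GaussianVector.
Context {R : realType} {d : measure_display} {T : measurableType d}.
Variables (P : probability T R) (I : finType) (X : I -> {RV P >-> R}).

Definition linform (a : I -> R) : T -> R := fun w => \sum_i a i * X i w.

Definition l1sum (w : T) : R := \sum_i `|X i w|.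

(* Dominated by an exponential of the l1 norm of the vector: an algebra of
   integrable functions that contains polynomials and exponentials of linear
   forms. *)
Definition expdom (f : T -> R) := measurable_fun setT f /\
  exists C c : R, [/\ 0 <= C, 0 <= c & forall w, `|f w| <= C * expR (c * l1sum w)].

Definition mean (f : T -> R) : R := \int[P]_w f w.

Lemma l1sum_ge0 w : 0 <= l1sum w.
Proof. exact: sumr_ge0. Qed.

Lemma measurable_lin a : measurable_fun setT (linform a).
Proof.
apply: measurable_sum => i; apply: measurable_funM => //; exact: measurable_funPT.
Qed.

Lemma lin_le a w : `|linform a w| <= (\sum_i `|a i|) * l1sum w.
Proof.
rewrite mulr_suml; apply: (le_trans (ler_norm_sum _ _ _)); apply: ler_sum => i _.
rewrite normrM ler_wpM2l // /l1sum (bigD1 i) //= lerDl; exact: sumr_ge0.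
Qed.

Lemma eq_expdom f g : f =1 g -> expdom f -> expdom g.
Proof. by move=> /funext ->. Qed.

Lemma eq_mean f g : f =1 g -> mean f = mean g.
Proof. by move=> /funext ->. Qed.

Lemma expdom_cst c : expdom (fun=> c).
Proof.
split; first exact: measurable_cst.
by exists `|c|, 0; split=> // w; rewrite mul0r expR0 mulr1.
Qed.

Lemma expdom_lin a : expdom (linform a).
Proof.
split; first exact: measurable_lin.
exists (\sum_i `|a i|), 1; split=> //; first exact: sumr_ge0.
move=> w; apply: (le_trans (lin_le _ _)).
rewrite ler_wpM2l ?sumr_ge0 // mul1r (le_trans _ (expR_ge1Dx _)) //.
by rewrite lerDr.
Qed.

Lemma expdomM f g : expdom f -> expdom g -> expdom (fun w => f w * g w).
Proof.
move=> [mf [C [c [C0 c0 h]]]] [mg [C' [c' [C0' c0' h']]]].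
split; first exact: measurable_funM.
exists (C * C'), (c + c'); split; rewrite ?mulr_ge0 ?addr_ge0 // => w.
rewrite mulrDl expRD normrM mulrACA; exact: ler_pM.
Qed.

Lemma expdomD f g : expdom f -> expdom g -> expdom (fun w => f w + g w).
Proof.
move=> [mf [C [c [C0 c0 h]]]] [mg [C' [c' [C0' c0' h']]]].
split; first exact: measurable_funD.
exists (C + C'), (c + c'); split; rewrite ?addr_ge0 // => w.
rewrite [leRHS]mulrDl (le_trans (ler_normD _ _)) // lerD //.
  apply: (le_trans (h w)); rewrite ler_wpM2l // ler_expR ler_wpM2r ?l1sum_ge0 //.
  by rewrite lerDl.
apply: (le_trans (h' w)); rewrite ler_wpM2l // ler_expR ler_wpM2r ?l1sum_ge0 //.
by rewrite lerDr.
Qed.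

Lemma expdomZ c f : expdom f -> expdom (fun w => c * f w).
Proof. by apply: expdomM; exact: expdom_cst. Qed.

Lemma expdomB f g : expdom f -> expdom g -> expdom (fun w => f w - g w).
Proof.
move=> hf /(expdomZ (-1)) hg.
have -> : (fun w => f w - g w) = (fun w => f w + -1 * g w).
  by apply/funext => w; rewrite mulN1r.
exact: expdomD.
Qed.

Lemma expdomX f k : expdom f -> expdom (fun w => f w ^+ k).
Proof.
move=> hf; elim: k => [|k IH]; first exact: expdom_cst.
have -> : (fun w => f w ^+ k.+1) = (fun w => f w * f w ^+ k).
  by apply/funext => w; rewrite exprS.
exact: expdomM.
Qed.

Lemma expdom_sum (J : Type) (s : seq J) (f : J -> T -> R) :
  (forall j, expdom (f j)) -> expdom (fun w => \sum_(j <- s) f j w).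
Proof.
move=> h; elim: s => [|j s IH].
  have -> : (fun w => \sum_(j <- [::]) f j w) = (fun=> 0).
    by apply/funext => w; rewrite big_nil.
  exact: expdom_cst.
have -> : (fun w => \sum_(j <- j :: s) f j w) = (fun w => f j w + \sum_(j <- s) f j w).
  by apply/funext => w; rewrite big_cons.
exact: expdomD.
Qed.

Lemma expdom_prod (J : Type) (s : seq J) (f : J -> T -> R) :
  (forall j, expdom (f j)) -> expdom (fun w => \prod_(j <- s) f j w).
Proof.
move=> h; elim: s => [|j s IH].
  have -> : (fun w => \prod_(j <- [::]) f j w) = (fun=> 1).
    by apply/funext => w; rewrite big_nil.
  exact: expdom_cst.
have -> : (fun w => \prod_(j <- j :: s) f j w) = (fun w => f j w * \prod_(j <- s) f j w).
  by apply/funext => w; rewrite big_cons.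
exact: expdomM.
Qed.

Lemma expdom_norm f : expdom f -> expdom (fun w => `|f w|).
Proof.
move=> [mf [C [c [C0 c0 h]]]]; split; first exact: measurableT_comp.
by exists C, c; split=> // w; rewrite normr_id.
Qed.

Lemma expdom_expR_norm_lin a : expdom (fun w => expR `|linform a w|).
Proof.
split.
  do 2 apply: measurableT_comp => //; exact: measurable_lin.
exists 1, (\sum_i `|a i|); split=> //; first exact: sumr_ge0.
by move=> w; rewrite mul1r ger0_norm ?expR_ge0 // ler_expR lin_le.
Qed.

Lemma expdom_expR_lin a : expdom (fun w => expR (linform a w)).
Proof.
split; first by apply: measurableT_comp => //; exact: measurable_lin.
exists 1, (\sum_i `|a i|); split=> //; first exact: sumr_ge0.
move=> w; rewrite mul1r ger0_norm ?expR_ge0 // ler_expR.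
exact: le_trans (ler_norm _) (lin_le _ _).
Qed.

Hypothesis X_gauss : gaussian_vector X.

Lemma mgf_lin a : exists m s : R, forall t,
  (\int[P]_w (expR (t * linform a w))%:E = (expR (t * m + t ^+ 2 * s ^+ 2 / 2))%:E)%E.
Proof.
have [m [s law]] := X_gauss a; exists m, s.
pose mY := isMeasurableFun.Build _ _ _ _ _ (measurable_lin a).
pose Y : {RV P >-> R} := HB.pack (linform a) mY.
exact: (mgf_gaussian_law (Y := Y) law).
Qed.

Lemma linZ t a w : linform (fun i => t * a i) w = t * linform a w.
Proof. by rewrite /linform mulr_sumr; apply: eq_bigr => i _; rewrite mulrA. Qed.

Lemma linD a b w : linform (fun i => a i + b i) w = linform a w + linform b w.
Proof. by rewrite /linform -big_split; apply: eq_bigr => i _; rewrite mulrDl. Qed.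

Lemma integrable_expR_lin a : P.-integrable setT (fun w => (expR (linform a w))%:E).
Proof.
have [m [s h]] := mgf_lin a.
apply/integrableP; split.
  by apply/measurable_EFinP; exact: (expdom_expR_lin a).1.
under eq_integral do rewrite gee0_abs ?lee_fin ?expR_ge0 //.
have -> : (fun w => (expR (linform a w))%:E) = (fun w => (expR (1 * linform a w))%:E).
  by apply/funext => w; rewrite mul1r.
by rewrite h ltry.
Qed.

(** The l1 norm is the linear form whose signs are those of the coordinates. The signs depend on
    [w], so the sum runs over all of them; each term has a known mean. *)
Lemma expR_l1sum_le c w : expR (c * l1sum w) <=
  \sum_(e : {ffun I -> bool}) expR (linform (fun i => c * (-1) ^+ e i) w).
Proof.
pose e0 := [ffun i => X i w < 0].
rewrite (bigD1 e0) //=; apply: ler_wpDr; first by apply: sumr_ge0 => e _; exact: expR_ge0.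
rewrite ler_expR /l1sum /linform mulr_sumr; apply: ler_sum => i _.
by rewrite ffunE -mulrA -normrEsign.
Qed.

Lemma expdom_integrable f : expdom f -> P.-integrable setT (EFin \o f).
Proof.
move=> [mf [C [c [C0 c0 h]]]].
apply: (@le_integrable _ _ _ P setT _ _ (fun w =>
  (C%:E * \sum_(e : {ffun I -> bool}) (expR (linform (fun i => c * (-1) ^+ e i) w))%:E)%E)) => //.
- exact/measurable_EFinP.
- move=> w _; rewrite sumEFin -EFinM /= lee_fin [leRHS]ger0_norm; last first.
    by rewrite mulr_ge0 // sumr_ge0 // => e _; exact: expR_ge0.
  by apply: (le_trans (h w)); rewrite ler_wpM2l // expR_l1sum_le.
- apply: integrableZl => //; apply: integrable_sum => // e _.
  exact: integrable_expR_lin.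
Qed.

Lemma meanD f g : expdom f -> expdom g -> mean (fun w => f w + g w) = mean f + mean g.
Proof. by move=> hf hg; apply: RintegralD => //; exact: expdom_integrable. Qed.

Lemma meanZ c f : expdom f -> mean (fun w => c * f w) = c * mean f.
Proof. by move=> hf; apply: RintegralZl => //; exact: expdom_integrable. Qed.

Lemma meanB f g : expdom f -> expdom g -> mean (fun w => f w - g w) = mean f - mean g.
Proof. by move=> hf hg; apply: RintegralB => //; exact: expdom_integrable. Qed.

Lemma mean_sum (J : Type) (s : seq J) (f : J -> T -> R) :
  (forall j, expdom (f j)) -> mean (fun w => \sum_(j <- s) f j w) = \sum_(j <- s) mean (f j).
Proof.
move=> h; elim: s => [|j s IH].
  rewrite big_nil -[RHS](mul0r (mean (fun=> 1))) -meanZ; last exact: expdom_cst.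
  by congr mean; apply/funext => w; rewrite big_nil mul0r.
rewrite big_cons -IH -meanD //; last exact: expdom_sum.
by congr mean; apply/funext => w; rewrite big_cons.
Qed.

Lemma mean_le f g : expdom f -> expdom g -> (forall w, f w <= g w) -> mean f <= mean g.
Proof. by move=> hf hg h; apply: le_Rintegral => //; exact: expdom_integrable. Qed.

Lemma mean_norm f : expdom f -> `|mean f| <= mean (fun w => `|f w|).
Proof. by move=> hf; apply: le_normr_Rintegral => //; exact: expdom_integrable. Qed.

Lemma mean_cst c : mean (fun=> c) = c.
Proof.
rewrite /mean Rintegral_cst // -[RHS]mulr1; congr (_ * _).
by rewrite -[RHS]/(fine 1%E); congr fine; exact: probability_setT.
Qed.

Lemma tangent_mean G a b : expdom G ->
  tangent (fun t => mean (fun w => G w * expR (linform (fun i => a i + t * b i) w)))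
    (mean (fun w => linform b w * G w * expR (linform a w))).
Proof.
move=> hG.
(* Dominates the second-order Taylor remainder, divided by [t^2], uniformly in [|t| <= 1]. *)
pose M w := `|G w| * expR (linform a w) * (linform b w ^+ 2 * expR `|linform b w|).
have hM : expdom M.
  apply: expdomM; first by apply: expdomM; [exact: expdom_norm|exact: expdom_expR_lin].
  by apply: expdomM; [apply: expdomX; exact: expdom_lin|exact: expdom_expR_norm_lin].
have e t w : linform (fun i => a i + t * b i) w = linform a w + t * linform b w.
  by rewrite linD linZ.
exists (mean M) => t t1.
have h1 s : expdom (fun w => G w * expR (linform (fun i => a i + s * b i) w)).
  by apply: expdomM => //; exact: expdom_expR_lin.
have h2 : expdom (fun w => linform b w * G w * expR (linform a w)).
  by apply: expdomM; [apply: expdomM => //; exact: expdom_lin|exact: expdom_expR_lin].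
rewrite -meanB // -meanZ // -meanB //; [|exact: expdomB|exact: expdomZ].
apply: (le_trans (mean_norm _)); first by apply: expdomB; [exact: expdomB|exact: expdomZ].
rewrite mulrC -meanZ //; apply: mean_le.
- by apply: expdom_norm; apply: expdomB; [exact: expdomB|exact: expdomZ].
- exact: expdomZ.
move=> w; rewrite !e mul0r addr0 expRD.
rewrite (_ : _ - _ - _ = G w * expR (linform a w) * (expR (t * linform b w) - 1 - t * linform b w));
  last by ring.
rewrite normrM normrM (ger0_norm (expR_ge0 _)) /M mulrCA ler_wpM2l ?mulr_ge0 ?expR_ge0 //.
apply: (le_trans (expR_taylor1 _)); rewrite exprMn -mulrA.
rewrite !ler_wpM2l ?sqr_ge0 // ler_expR normrM ler_piMl //.
Qed.

End GaussianVector.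

(** * Wick's formula *)

Section Wick.
Context {R : realType} {d : measure_display} {T : measurableType d}.
Variables (P : probability T R) (I : finType) (X : I -> {RV P >-> R}).
Hypothesis X_gauss : gaussian_vector X.
Hypothesis X_centered : forall i, ('E_P[X i] = 0)%E.

Local Notation lin := (linform X).
Local Notation Ex := (mean P).
Local Notation expdom := (expdom X).

Definition covform (a b : I -> R) : R := Ex (fun w => lin a w * lin b w).

Lemma expdom_coord i : expdom (X i).
Proof.
have -> : (X i : T -> R) = lin (fun j => (j == i)%:R).
  apply/funext => w; rewrite /linform (bigD1 i) //= eqxx mul1r big1 ?addr0 // => j /negbTE ->.
  by rewrite mul0r.
exact: expdom_lin.
Qed.

Lemma mean_lin a : Ex (lin a) = 0.
Proof.
rewrite /linform (mean_sum X_gauss) => [|i]; last first.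
  by apply: expdomZ; exact: expdom_coord.
rewrite big1 // => i _; rewrite (meanZ X_gauss); last exact: expdom_coord.
have := X_centered i; rewrite unlock /mean /Rintegral => ->.
by rewrite mulr0.
Qed.

Lemma lin_scale_add t a w : lin (fun i => 0 + t * a i) w = t * lin a w.
Proof. by rewrite -linZ; congr lin; apply/funext => i; rewrite add0r. Qed.

Lemma lin0 w : lin (fun=> 0) w = 0.
Proof. by rewrite /linform big1 // => i _; rewrite mul0r. Qed.

(** The parameters [m] and [s] of the law are anonymous in the definition of a Gaussian vector.
    Expanding the moment generating function identifies them: the first order at 0 gives [m = 0] by
    centering, and a further expansion shows that [s ^+ 2] is the variance. *)
Lemma mean_expR_lin a : Ex (fun w => expR (lin a w)) = expR (covform a a / 2).
Proof.
have [m [s h]] := mgf_lin X_gauss a.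
have mgf t : Ex (fun w => expR (t * lin a w)) = expR (t * m + t ^+ 2 * (s ^+ 2 / 2)).
  by rewrite /mean /Rintegral h /= mulrA.
have tg t0 : tangent (fun t => Ex (fun w => expR ((t0 + t) * lin a w)))
    (Ex (fun w => lin a w * expR (t0 * lin a w))).
  have := tangent_mean X_gauss (fun i => t0 * a i) a (expdom_cst X 1).
  have -> : Ex (fun w => lin a w * 1 * expR (lin (fun i => t0 * a i) w)) =
     Ex (fun w => lin a w * expR (t0 * lin a w)).
    by congr Ex; apply/funext => w; rewrite mulr1 linZ.
  apply: eq_tangent => t; congr Ex; apply/funext => w.
  by rewrite mul1r linD !linZ mulrDl.
have m0 : m = 0.
  have := tg 0.
  have -> : Ex (fun w => lin a w * expR (0 * lin a w)) = 0.
    rewrite -[RHS](mean_lin a); congr Ex; apply/funext => w.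
    by rewrite mul0r expR0 mulr1.
  move=> h0; apply/esym/(tangent_unique h0); have := tangent_expR m (s ^+ 2 / 2).
  by apply: eq_tangent => t; rewrite add0r mgf.
rewrite m0 {m0} in mgf.
pose v := s ^+ 2.
(* The derivative at an arbitrary [t0]; its own expansion at 0 then yields the second moment. *)
have first_order t0 : Ex (fun w => lin a w * expR (t0 * lin a w)) =
    t0 * v * expR (t0 ^+ 2 * (v / 2)).
  apply: tangent_unique (tg t0) _.
  have := tangent_scale (expR (t0 ^+ 2 * (v / 2))) (tangent_expR (t0 * v) (v / 2)).
  rewrite [_ * (t0 * v)]mulrC; apply: eq_tangent => t; rewrite mgf -expRD.
  by congr expR; rewrite /v; field.
have <- : v = covform a a.
  have t1 : tangent (fun t => t * v * expR (t * 0 + t ^+ 2 * (v / 2))) v.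
    have := tangentM (tangent_affine 0 v) (tangent_expR 0 (v / 2)).
    rewrite expr0n !mul0r !addr0 expR0 mulr1 mulr0 addr0.
    by apply: eq_tangent => t; rewrite add0r.
  apply: tangent_unique t1 _.
  have := tangent_mean X_gauss (fun=> 0) a (expdom_lin X a).
  have -> : Ex (fun w => lin a w * lin a w * expR (lin (fun=> 0) w)) = covform a a.
    by congr Ex; apply/funext => w; rewrite lin0 expR0 mulr1.
  apply: eq_tangent => t; rewrite mulr0 add0r -first_order; congr Ex.
  by apply/funext => w; rewrite lin_scale_add.
have := mgf 1; rewrite expr1n !mul1r add0r => <-.
by congr Ex; apply/funext => w; rewrite mul1r.
Qed.

Lemma covformDZr a b c t : covform a (fun i => b i + t * c i) = covform a b + t * covform a c.
Proof.
have hl b' : expdom (fun w => lin a w * lin b' w) by apply: expdomM; exact: expdom_lin.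
rewrite /covform -(meanZ X_gauss) // -(meanD X_gauss) //; last exact: expdomZ.
by congr Ex; apply/funext => w; rewrite linD linZ mulrDr mulrCA.
Qed.

Lemma covformC a b : covform a b = covform b a.
Proof. by congr Ex; apply/funext => w; rewrite mulrC. Qed.

(** Moments under an exponential tilt, which gives a parameter to differentiate in; those wanted are
    at [a = 0]. *)
Definition expmoment (s : seq (I -> R)) (a : I -> R) : R :=
  Ex (fun w => (\prod_(b <- s) lin b w) * expR (lin a w)).

Lemma tangent_expmoment s a b :
  tangent (fun t => expmoment s (fun i => a i + t * b i)) (expmoment (b :: s) a).
Proof.
have hG : expdom (fun w => \prod_(c <- s) lin c w).
  by apply: expdom_prod => c; exact: expdom_lin.
have := tangent_mean X_gauss a b hG.
have -> : Ex (fun w => lin b w * (\prod_(c <- s) lin c w) * expR (lin a w)) =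
   expmoment (b :: s) a.
  by congr Ex; apply/funext => w; rewrite big_cons.
by apply: eq_tangent.
Qed.

Lemma add_scale0 (a b : I -> R) : (fun i => a i + 0 * b i) = a.
Proof. by apply/funext => i; rewrite mul0r addr0. Qed.

(* Inserting a factor in the product is differentiating in the exponent. *)
Lemma wick_expmoment s z a :
  expmoment (z :: s) a =
  covform z a * expmoment s a + removals s (fun b t => covform z b * expmoment t a).
Proof.
elim: s a => [|u s IH] a.
  rewrite /= addr0.
  apply: tangent_unique (tangent_expmoment [::] a z) _.
  have e b : expmoment [::] b = expR (covform b b / 2).
    rewrite -mean_expR_lin; congr Ex; apply/funext => w.
    by rewrite big_nil mul1r.
  rewrite e mulrC.
  have := tangent_scale (expR (covform a a / 2)) (tangent_expR (covform z a) (covform z z / 2)).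
  apply: eq_tangent => t; rewrite e -expRD; congr expR.
  have eb c : covform (fun i => a i + t * z i) c = covform c a + t * covform c z.
    by rewrite covformC covformDZr.
  by rewrite [in RHS]covformDZr !eb (covformC a z); field.
(* The factor [u] is produced by differentiating the induction hypothesis for [z :: s] along [u];
   the derivative of [covform z a] is the new pairing of [z] with [u]. *)
have perm_zu : expmoment [:: z, u & s] a = expmoment [:: u, z & s] a.
  by congr Ex; apply/funext => w; rewrite !big_cons mulrCA.
rewrite perm_zu; apply: tangent_unique (tangent_expmoment (z :: s) a u) _.
apply: (@eq_tangent _ (fun t =>
   (covform z a + t * covform z u) * expmoment s (fun i => a i + t * u i) +
   removals s (fun b r => covform z b * expmoment r (fun i => a i + t * u i)))).
  by move=> t; rewrite IH covformDZr.
have h1 := tangentM (tangent_affine (covform z a) (covform z u)) (tangent_expmoment s a u).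
have h2 := tangent_removals s (fun b r => tangent_scale (covform z b) (tangent_expmoment r a u)).
have := tangentD h1 h2; rewrite add_scale0; set l := (X in tangent _ X).
suff -> : l = covform z a * expmoment (u :: s) a +
  removals (u :: s) (fun b t => covform z b * expmoment t a) by [].
by rewrite /l /=; ring.
Qed.

Lemma wick s z :
  Ex (fun w => lin z w * \prod_(b <- s) lin b w) =
  removals s (fun b t => covform z b * Ex (fun w => \prod_(c <- t) lin c w)).
Proof.
have e t : expmoment t (fun=> 0) = Ex (fun w => \prod_(c <- t) lin c w).
  by congr Ex; apply/funext => w; rewrite lin0 expR0 mulr1.
transitivity (expmoment (z :: s) (fun=> 0)).
  by rewrite e; congr Ex; apply/funext => w; rewrite big_cons.
rewrite wick_expmoment (_ : covform z (fun=> 0) = 0) ?mul0r ?add0r.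
  by apply: eq_removals => b t; rewrite e.
rewrite -[RHS](mean_cst P 0); congr Ex; apply/funext => w.
by rewrite lin0 mulr0.
Qed.

End Wick.

(** * The random matrix *)

Lemma triu_pairC n (i j : 'I_n) : triu_pair i j = triu_pair j i.
Proof.
by apply: val_inj => /=; case: ltngtP => // /ord_inj ->.
Qed.

Lemma triu_pair_inj n (i j i' j' : 'I_n) : triu_pair i j = triu_pair i' j' ->
  (i = i' /\ j = j') \/ (i = j' /\ j = i').
Proof.
by move=> /(congr1 val) /=; case: ifP => _; case: ifP => _ [-> ->]; auto.
Qed.

Lemma removals_map (R : realFieldType) (A B : Type) (f : A -> B) (s : seq A)
    (psi : B -> seq B -> R) :
  removals (map f s) psi = removals s (fun g t => psi (f g) (map f t)).
Proof. by elim: s psi => [|x s IH] psi //=; rewrite IH. Qed.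

Lemma normr_removals (R : realFieldType) (A : Type) (s : seq A) (psi : A -> seq A -> R) :
  `|removals s psi| <= removals s (fun g t => `|psi g t|).
Proof.
elim: s psi => [|x s IH] psi /=; first by rewrite normr0.
by apply: (le_trans (ler_normD _ _)); rewrite lerD2l.
Qed.

Section Moments.
Context {R : realType} {d : measure_display} {T : measurableType d}.
Variables (P : probability T R) (n : nat) (X : triu n.+1 -> {RV P >-> R}) (rho : R).
Hypothesis X_gauss : gaussian_vector X.
Hypothesis X_centered : forall p, ('E_P[X p] = 0)%E.
Hypothesis X_sqr : forall p, mean P (fun w => X p w * X p w) = 1.
Hypothesis X_cov : forall p q, p != q -> `|mean P (fun w => X p w * X q w)| <= rho.
Hypothesis rho_ge0 : 0 <= rho.

Local Notation Ex := (mean P).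
Local Notation expdom := (expdom X).

Definition coord (p : triu n.+1) : triu n.+1 -> R := fun q => (q == p)%:R.

Lemma lin_coord p w : linform X (coord p) w = X p w.
Proof.
rewrite /linform (bigD1 p) //= /coord eqxx mul1r big1 ?addr0 // => j /negbTE ->.
by rewrite mul0r.
Qed.

Definition absmoment (s : seq (triu n.+1)) : R := `|Ex (fun w => \prod_(p <- s) X p w)|.

Lemma absmoment_ge0 s : 0 <= absmoment s.
Proof. exact: normr_ge0. Qed.

Lemma absmoment_perm s t : perm_eq s t -> absmoment s = absmoment t.
Proof.
move=> st; rewrite /absmoment; congr `|Ex _|; apply/funext => w.
exact: perm_big.
Qed.

Lemma absmoment_nil : absmoment [::] <= 1.
Proof.
rewrite /absmoment (_ : (fun w => _) = fun=> 1) ?mean_cst ?normr1 //.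
by apply/funext => w; rewrite big_nil.
Qed.

Lemma absmoment_wick p s :
  absmoment (p :: s) <= removals s (fun q t => ecov rho p q * absmoment t).
Proof.
have e t : Ex (fun w => \prod_(c <- map coord t) linform X c w) =
    Ex (fun w => \prod_(q <- t) X q w).
  congr Ex; apply/funext => w; rewrite big_map; apply: eq_bigr => q _.
  exact: lin_coord.
have := wick X_gauss X_centered (map coord s) (coord p); rewrite removals_map => h.
rewrite /absmoment.
have -> : Ex (fun w => \prod_(q <- p :: s) X q w) =
    Ex (fun w => linform X (coord p) w * \prod_(b <- map coord s) linform X b w).
  congr Ex; apply/funext => w; rewrite big_cons lin_coord; congr (_ * _).
  by rewrite big_map; apply: eq_bigr => q _; rewrite lin_coord.
rewrite h; apply: (le_trans (normr_removals _ _)); apply: ler_removals => q t.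
rewrite normrM e ler_wpM2r // /covform.
rewrite (@eq_mean _ _ _ _ _ (fun w => X p w * X q w)); last first.
  by move=> w; rewrite !lin_coord.
rewrite /ecov; case: eqVneq => [<-|pq].
  by rewrite X_sqr normr1 lerDl.
by rewrite add0r X_cov.
Qed.

Local Notation M w := (sym_mx (fun p => X p w) : 'M[R]_n.+1).

Lemma expdom_mxpow q u v : expdom (fun w => (M w ^+ q) u v).
Proof.
elim: q u => [|q IH] u.
  by apply: eq_expdom (expdom_cst X (u == v)%:R) => w; rewrite expr0 mxE.
apply: (@eq_expdom _ _ _ _ _ _ (fun w => \sum_z M w u z * (M w ^+ q) z v)).
  by move=> w; rewrite exprS mxE.
apply: expdom_sum => z; apply: expdomM => //.
by apply: eq_expdom (expdom_coord X (triu_pair u z)) => w; rewrite mxE.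
Qed.

Lemma expdom_prod_coord s : expdom (fun w => \prod_(p <- s) X p w).
Proof. by apply: expdom_prod => p; exact: expdom_coord. Qed.

(** The list [s] collects the entries already expanded. Summing absolute values over every end [v],
    not just [v = u], is what turns closed walks into open ones. *)
Lemma mxpow_moment_le q u s :
  \sum_v `|Ex (fun w => (M w ^+ q) u v * \prod_(p <- s) X p w)| <=
  tsum q (fun w => absmoment (edges (@triu_pair n.+1) (u :: w) ++ s)).
Proof.
elim: q u s => [|q IH] u s.
  rewrite (bigD1 u) //= big1 ?addr0 => [|v vu].
    rewrite le_eqVlt; apply/orP; left; apply/eqP; congr `|Ex _|.
    by apply/funext => w; rewrite expr0 mxE eqxx mul1r.
  rewrite (_ : (fun w => _) = fun=> 0) ?mean_cst ?normr0 //.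
  by apply/funext => w; rewrite expr0 mxE eq_sym (negbTE vu) mul0r.
apply: (@le_trans _ _ (\sum_z \sum_v
   `|Ex (fun w => (M w ^+ q) z v * \prod_(p <- triu_pair u z :: s) X p w)|)).
  rewrite exchange_big; apply: ler_sum => v _.
  apply: le_trans (ler_norm_sum _ _ _).
  rewrite le_eqVlt; apply/orP; left; apply/eqP; congr `|_|.
  rewrite -(mean_sum X_gauss) => [|z]; last first.
    by apply: expdomM; [exact: expdom_mxpow|exact: expdom_prod_coord].
  congr Ex; apply/funext => w; rewrite exprS mxE mulr_suml.
  by apply: eq_bigr => z _; rewrite big_cons mxE mulrCA mulrA.
rewrite -[leRHS]/(\sum_z tsum q (fun w =>
  absmoment (edges (@triu_pair n.+1) [:: u, z & w] ++ s))).
apply: ler_sum => z _; apply: (le_trans (IH _ _)); apply: ler_tsum => w _.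
rewrite le_eqVlt; apply/orP; left; apply/eqP; apply: absmoment_perm.
have := perm_catCA (edges (@triu_pair n.+1) (z :: w)) [:: triu_pair u z] s.
by move=> ->; exact: perm_refl.
Qed.

Lemma trace_moment_le q N : (q <= N)%N ->
  n.+1%:R * rho <= 1 ->
  N.+1%:R ^+ 5 * (2 + n.+1%:R * (n.+1%:R * rho)) <= 128 * n.+1%:R ->
  Ex (fun w => \tr (M w ^+ q)) <= n.+1%:R * (16 * Num.sqrt n.+1%:R) ^+ q.
Proof.
move=> qN r1 hN.
apply: (@le_trans _ _ (Wsum (@triu_pair n.+1) absmoment [:: q])).
  rewrite /mxtrace (mean_sum X_gauss) => [|u]; last exact: expdom_mxpow.
  apply: ler_sum => u _.
  apply: (@le_trans _ _ (\sum_v `|Ex (fun w => (M w ^+ q) u v * \prod_(p <- [::]) X p w)|)).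
    rewrite (bigD1 u) //= (_ : (fun w => (M w ^+ q) u u * _) = (fun w => (M w ^+ q) u u)).
      by rewrite (le_trans (ler_norm _)) // lerDl sumr_ge0.
    by apply/funext => w; rewrite big_nil mulr1.
  exact: mxpow_moment_le.
have n0 : 0 < n.+1%:R :> R by [].
(* The solution of [theta^2 = 256 n]. *)
pose th := 16 * Num.sqrt n.+1%:R : R.
have th0 : 0 < th by rewrite mulr_gt0 // sqrtr_gt0.
have h : Wsum (@triu_pair n.+1) absmoment [:: q] <= \prod_(l <- [:: q]) wt 'I_n.+1 th l.
  apply: (Wsum_bound (@triu_pairC n.+1) (@triu_pair_inj n.+1) ord0 rho_ge0
    absmoment_ge0 absmoment_perm absmoment_nil absmoment_wick (N := N)) => //;
    rewrite ?card_ord //.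
  - by rewrite /th exprMn sqr_sqrtr ?ler0n //; lra.
  - by rewrite /= addn0.
apply: (le_trans h); rewrite big_cons big_nil mulr1.
by have := wt_le 'I_n.+1 q (ltW th0); rewrite card_ord.
Qed.

End Moments.

(** * Second and fourth moments of the row sums *)

Section RowSums.
Context {R : realType} {d : measure_display} {T : measurableType d}.
Variables (P : probability T R) (n : nat) (X : triu n.+1 -> {RV P >-> R}) (rho : R).
Hypothesis X_gauss : gaussian_vector X.
Hypothesis X_centered : forall p, ('E_P[X p] = 0)%E.
Hypothesis X_sqr : forall p, mean P (fun w => X p w * X p w) = 1.
Hypothesis X_cov : forall p q, p != q -> `|mean P (fun w => X p w * X q w)| <= rho.
Hypothesis rho_ge0 : 0 <= rho.

Local Notation Ex := (mean P).
Local Notation expdom := (expdom X).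
Local Notation lin := (linform X).
Local Notation cov2 := (covform X).
Local Notation N := (n.+1%:R : R).

Lemma sum_const_ord (c : R) : \sum_(i < n.+1) c = N * c.
Proof. by rewrite sumr_const card_ord mulr_natl. Qed.

Lemma wick4 a b : Ex (fun w => lin a w ^+ 2 * lin b w ^+ 2) =
  cov2 a a * cov2 b b + 2 * cov2 a b ^+ 2.
Proof.
have two u v : Ex (fun w => \prod_(c <- [:: u; v]) lin c w) = cov2 u v.
  by apply: eq_mean => w; rewrite !big_cons big_nil mulr1.
have := wick X_gauss X_centered [:: a; b; b] a; rewrite /= !two addr0 => h.
transitivity (Ex (fun w => lin a w * \prod_(b <- [:: a; b; b]) lin b w)).
  by apply: eq_mean => w; rewrite !big_cons big_nil; ring.
by rewrite h; ring.
Qed.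

(** A coefficient vector, so that row sums are linear forms and [wick4] applies to them. *)
Definition rowsum (j : 'I_n.+1) : triu n.+1 -> R := fun p => \sum_i coord (triu_pair i j) p.

Lemma lin_sum (I : Type) (s : seq I) (a : I -> triu n.+1 -> R) w :
  lin (fun p => \sum_(i <- s) a i p) w = \sum_(i <- s) lin (a i) w.
Proof.
rewrite /linform exchange_big; apply: eq_bigr => p _; by rewrite mulr_suml.
Qed.

Lemma lin_rowsum j w : lin (rowsum j) w = \sum_i X (triu_pair i j) w.
Proof. by rewrite lin_sum; apply: eq_bigr => i _; rewrite lin_coord. Qed.

Lemma covform_suml (I : Type) (s : seq I) (a : I -> triu n.+1 -> R) b :
  cov2 (fun p => \sum_(i <- s) a i p) b = \sum_(i <- s) cov2 (a i) b.
Proof.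
rewrite /covform -(mean_sum X_gauss) => [|i]; last by apply: expdomM; exact: expdom_lin.
by apply: eq_mean => w; rewrite lin_sum mulr_suml.
Qed.

Lemma covform_sumr (I : Type) (s : seq I) (a : I -> triu n.+1 -> R) b :
  cov2 b (fun p => \sum_(i <- s) a i p) = \sum_(i <- s) cov2 b (a i).
Proof. by rewrite covformC covform_suml; apply: eq_bigr => i _; rewrite covformC. Qed.

Lemma covform_coord p q : `|cov2 (coord p) (coord q) - (p == q)%:R| <= rho.
Proof.
rewrite /covform (@eq_mean _ _ _ _ _ (fun w => X p w * X q w)); last first.
  by move=> w; rewrite !lin_coord.
have [<-|pq] := eqVneq p q; first by rewrite X_sqr subrr normr0.
by rewrite subr0 X_cov.
Qed.

Let kappa := N * rho.

(** [cnt] is the value for uncorrelated entries; each of the [N^2] pairs of entries is off by at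
    most [rho], and [N^2 rho = kappa N]. *)
Lemma covform_rowsum_near (j k : 'I_n.+1) (cnt : R) :
  \sum_i \sum_i' ((triu_pair i j == triu_pair i' k)%:R : R) = cnt ->
  `|cov2 (rowsum j) (rowsum k) - cnt| <= kappa * N.
Proof.
move=> <-; rewrite covform_suml -sumrB; apply: (le_trans (ler_norm_sum _ _ _)).
have -> : kappa * N = \sum_(i < n.+1) \sum_(i' < n.+1) rho.
  by rewrite !sum_const_ord /kappa; ring.
apply: ler_sum => i _; rewrite covform_sumr -sumrB; apply: (le_trans (ler_norm_sum _ _ _)).
by apply: ler_sum => i' _; exact: covform_coord.
Qed.

Lemma covform_rowsum_diag j : `|cov2 (rowsum j) (rowsum j) - N| <= kappa * N.
Proof.
apply: covform_rowsum_near; rewrite (eq_bigr (fun=> 1)) => [|i _].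
  by rewrite sum_const_ord mulr1.
rewrite (bigD1 i) //= eqxx big1 ?addr0 // => i' /negbTE i'i.
case: eqP => // /triu_pair_inj [[ii' _]|[ij ji']].
  by rewrite ii' eqxx in i'i.
by rewrite -ji' ij eqxx in i'i.
Qed.

(** By symmetry two different rows have exactly one entry in common, which accounts for the 1. *)
Lemma covform_rowsum_offdiag j k : j != k ->
  `|cov2 (rowsum j) (rowsum k)| <= 1 + kappa * N.
Proof.
move=> jk; have := @covform_rowsum_near j k 1.
have -> : \sum_i \sum_i' ((triu_pair i j == triu_pair i' k)%:R : R) = 1.
  rewrite (bigD1 k) //= (bigD1 j) //= triu_pairC eqxx big1 => [|i' i'j].
    rewrite big1 ?addr0 // => i ik; rewrite big1 // => i' _.
    case: eqP => // /triu_pair_inj [[_ e]|[e _]]; first by rewrite e eqxx in jk.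
    by rewrite e eqxx in ik.
  case: eqP => // /triu_pair_inj [[e _]|[e _]]; last by rewrite e eqxx in jk.
  by rewrite -e eqxx in i'j.
move=> /(_ erefl) h; have -> : cov2 (rowsum j) (rowsum k) = 1 + (cov2 (rowsum j) (rowsum k) - 1).
  by ring.
by apply: (le_trans (ler_normD _ _)); rewrite normr1 lerD2l.
Qed.

Let S j k := cov2 (rowsum j) (rowsum k).

Let kappa_ge0 : 0 <= kappa. Proof. by rewrite mulr_ge0. Qed.

Lemma sum_covform_rowsum : kappa <= 1 ->
  `|\sum_j \sum_k S j k| <= 3 * N ^+ 2 + kappa * N ^+ 3.
Proof.
move=> k1; apply: (le_trans (ler_norm_sum _ _ _)).
apply: (@le_trans _ _ (\sum_(j < n.+1) (2 * N + N * (1 + kappa * N)))); last first.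
  by rewrite sum_const_ord le_eqVlt; apply/orP; left; apply/eqP; ring.
apply: ler_sum => j _; apply: (le_trans (ler_norm_sum _ _ _)).
rewrite (bigD1 j) //= lerD //.
  have := covform_rowsum_diag j; rewrite -/(S j j) => h.
  have -> : S j j = (S j j - N) + N by ring.
  apply: (le_trans (ler_normD _ _)); rewrite normr_nat.
  have : kappa * N <= N by rewrite ler_piMl.
  lra.
apply: (@le_trans _ _ (\sum_(k < n.+1 | k != j) (1 + kappa * N))).
  by apply: ler_sum => k kj; apply: covform_rowsum_offdiag; rewrite eq_sym.
rewrite sumr_const -[leLHS]mulr_natl ler_wpM2r ?addr_ge0 ?mulr_ge0 // ler_nat.
by apply: (leq_trans (max_card _)); rewrite card_ord.
Qed.

(** The [N] diagonal terms are of order [N^2], the others only of order [1 + (kappa N)^2]. *)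
Lemma sum_covform_rowsum_sqr : kappa <= 1 ->
  \sum_j \sum_k S j k ^+ 2 <= 6 * N ^+ 3 + 2 * kappa ^+ 2 * N ^+ 4.
Proof.
move=> k1.
have N1 : 1 <= N by rewrite ler1n.
apply: (@le_trans _ _ (\sum_(j < n.+1) (4 * N ^+ 2 + N * (2 + 2 * (kappa * N) ^+ 2)))); last first.
  rewrite sum_const_ord -subr_ge0.
  have -> : 6 * N ^+ 3 + 2 * kappa ^+ 2 * N ^+ 4 -
     N * (4 * N ^+ 2 + N * (2 + 2 * (kappa * N) ^+ 2)) = 2 * N ^+ 2 * (N - 1) by ring.
  by rewrite mulr_ge0 ?mulr_ge0 ?sqr_ge0 // subr_ge0.
apply: ler_sum => j _; rewrite (bigD1 j) //= lerD //.
  rewrite -[S j j ^+ 2]real_normK ?num_real //.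
  have -> : 4 * N ^+ 2 = (2 * N) ^+ 2 by ring.
  apply: lerXn2r; rewrite ?nnegrE ?mulr_ge0 //.
  have := covform_rowsum_diag j; rewrite -/(S j j) => h.
  have -> : S j j = (S j j - N) + N by ring.
  apply: (le_trans (ler_normD _ _)); rewrite normr_nat.
  have : kappa * N <= N by rewrite ler_piMl.
  lra.
apply: (@le_trans _ _ (\sum_(k < n.+1 | k != j) (2 + 2 * (kappa * N) ^+ 2))).
  apply: ler_sum => k kj; have jk : j != k by rewrite eq_sym.
  have := covform_rowsum_offdiag jk; rewrite -/(S j k) => h.
  apply: (@le_trans _ _ ((1 + kappa * N) ^+ 2)).
    by rewrite -[S j k ^+ 2]real_normK ?num_real // lerXn2r // nnegrE addr_ge0 ?mulr_ge0.
  have := sqr_ge0 (1 - kappa * N); set z := kappa * N.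
  rewrite -subr_ge0 => h2; rewrite -subr_ge0.
  by have -> : 2 + 2 * z ^+ 2 - (1 + z) ^+ 2 = (1 - z) ^+ 2 - 0 by ring.
rewrite sumr_const -[leLHS]mulr_natl ler_wpM2r ?addr_ge0 ?mulr_ge0 ?sqr_ge0 // ler_nat.
by apply: (leq_trans (max_card _)); rewrite card_ord.
Qed.

(** In the notation of the overview this is [|We|^2], and [totsum] is [N^(3/2) a]. *)
Definition meansq w : R := (\sum_j lin (rowsum j) w ^+ 2) / N ^+ 2.
Definition totsum w : R := \sum_j lin (rowsum j) w.

Lemma expdom_meansq : expdom meansq.
Proof.
rewrite /meansq; apply: expdomM; last exact: expdom_cst.
by apply: expdom_sum => j; apply: expdomX; exact: expdom_lin.
Qed.

Lemma expdom_totsum : expdom totsum.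
Proof. by apply: expdom_sum => j; exact: expdom_lin. Qed.

(** Squared bias plus variance: the mean is within [kappa] of 1, and by [wick4] the variance is
    twice the sum of the squared covariances over [N^4]. *)
Lemma mean_meansq_sqr : kappa <= 1 ->
  Ex (fun w => (meansq w - 1) ^+ 2) <= 12 / N + 5 * kappa ^+ 2.
Proof.
move=> k1; have N0 : N != 0 by rewrite pnatr_eq0.
pose m := (\sum_j S j j) / N ^+ 2.
have e1 : Ex (fun w => meansq w) = m.
  rewrite /m mulrC.
  rewrite (@eq_mean _ _ _ _ _ (fun w => N ^- 2 * \sum_j lin (rowsum j) w ^+ 2)); last first.
    by move=> w; rewrite /meansq mulrC.
  rewrite (meanZ X_gauss); last first.
    by apply: expdom_sum => j; apply: expdomX; exact: expdom_lin.
  rewrite (mean_sum X_gauss) => [|j]; last by apply: expdomX; exact: expdom_lin.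
  by congr (_ * _); apply: eq_bigr => j _; apply: eq_mean => w; rewrite expr2.
have h4 j k : expdom (fun w => lin (rowsum j) w ^+ 2 * lin (rowsum k) w ^+ 2).
  by apply: expdomM; apply: expdomX; exact: expdom_lin.
have e2 : Ex (fun w => meansq w ^+ 2) = m ^+ 2 + 2 * (\sum_j \sum_k S j k ^+ 2) / N ^+ 4.
  transitivity (Ex (fun w =>
      N ^- 4 * \sum_j \sum_k (lin (rowsum j) w ^+ 2 * lin (rowsum k) w ^+ 2))).
    apply: eq_mean => w; rewrite /meansq exprMn expr2 mulrC; congr (_ * _).
      by rewrite -exprVn -exprM exprVn.
    by rewrite mulr_suml; apply: eq_bigr => j _; rewrite mulr_sumr.
  rewrite (meanZ X_gauss); last by do 2 apply: expdom_sum => ?.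
  rewrite (mean_sum X_gauss) => [|j]; last by apply: expdom_sum => k.
  have -> : \sum_j Ex (fun w => \sum_k lin (rowsum j) w ^+ 2 * lin (rowsum k) w ^+ 2) =
     (\sum_j S j j) ^+ 2 + 2 * \sum_j \sum_k S j k ^+ 2.
    rewrite expr2 mulr_suml mulr_sumr -big_split; apply: eq_bigr => j _.
    rewrite (mean_sum X_gauss) // mulr_sumr mulr_sumr -big_split; apply: eq_bigr => k _.
    by rewrite wick4.
  by rewrite /m; field.
have -> : Ex (fun w => (meansq w - 1) ^+ 2) =
    (m - 1) ^+ 2 + 2 * (\sum_j \sum_k S j k ^+ 2) / N ^+ 4.
  transitivity (Ex (fun w => meansq w ^+ 2 + ((-2) * meansq w + 1))).
    by apply: eq_mean => w; ring.
  have hm := expdom_meansq.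
  rewrite (meanD X_gauss); [|exact: expdomX|by apply: expdomD; [exact: expdomZ|exact: expdom_cst]].
  rewrite (meanD X_gauss); [|exact: expdomZ|exact: expdom_cst].
  rewrite (meanZ X_gauss) // mean_cst e1 e2; ring.
have hm : `|m - 1| <= kappa.
  have -> : m - 1 = (\sum_j (S j j - N)) / N ^+ 2.
    by rewrite sumrB sum_const_ord /m; field.
  rewrite normrM normfV normrX normr_nat ler_pdivrMr ?exprn_gt0 //.
  apply: (le_trans (ler_norm_sum _ _ _)).
  apply: (@le_trans _ _ (\sum_(j < n.+1) (kappa * N))).
    by apply: ler_sum => j _; exact: covform_rowsum_diag.
  by rewrite sum_const_ord le_eqVlt; apply/orP; left; apply/eqP; ring.
have hm2 : (m - 1) ^+ 2 <= kappa ^+ 2.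
  by rewrite -[(m - 1) ^+ 2]real_normK ?num_real // lerXn2r // nnegrE.
have hS : 2 * (\sum_j \sum_k S j k ^+ 2) / N ^+ 4 <= 12 / N + 4 * kappa ^+ 2.
  rewrite ler_pdivrMr ?exprn_gt0 //.
  have -> : (12 / N + 4 * kappa ^+ 2) * N ^+ 4 = 2 * (6 * N ^+ 3 + 2 * kappa ^+ 2 * N ^+ 4).
    by field.
  by rewrite ler_wpM2l // sum_covform_rowsum_sqr.
apply: le_trans (lerD hm2 hS) _.
by rewrite le_eqVlt; apply/orP; left; apply/eqP; ring.
Qed.

(** The total sum is a single linear form, so its fourth moment is three times its squared variance;
    the variance over [N^3] is at most [3 / N + kappa], and [54 = 3 * 2 * 9]. *)
Lemma mean_totsum4 : kappa <= 1 ->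
  Ex (fun w => (totsum w ^+ 2 / N ^+ 3) ^+ 2) <= 54 / N + 6 * kappa ^+ 2.
Proof.
move=> k1; have N0 : N != 0 by rewrite pnatr_eq0.
pose g := fun p => \sum_j rowsum j p.
have gE w : lin g w = totsum w by exact: lin_sum.
have -> : Ex (fun w => (totsum w ^+ 2 / N ^+ 3) ^+ 2) = 3 * (cov2 g g / N ^+ 3) ^+ 2.
  transitivity (Ex (fun w => N ^- 6 * (lin g w ^+ 2 * lin g w ^+ 2))).
    by apply: eq_mean => w; rewrite gE; field.
  rewrite (meanZ X_gauss) ?wick4; last by apply: expdomM; apply: expdomX; exact: expdom_lin.
  by field.
have hg : `|cov2 g g / N ^+ 3| <= 3 / N + kappa.
  rewrite normrM normfV normrX normr_nat ler_pdivrMr ?exprn_gt0 //.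
  have -> : (3 / N + kappa) * N ^+ 3 = 3 * N ^+ 2 + kappa * N ^+ 3 by field.
  rewrite covform_suml; under eq_bigr do rewrite covform_sumr.
  exact: sum_covform_rowsum.
have hN : 0 <= N^-1 <= 1 by rewrite invr_ge0 ler0n invf_le1 ?ler1n.
have : (cov2 g g / N ^+ 3) ^+ 2 <= (3 / N + kappa) ^+ 2.
  rewrite -[X in X <= _]real_normK ?num_real //.
  apply: lerXn2r => //; rewrite nnegrE //.
  by apply: addr_ge0 => //; apply: divr_ge0.
move: hN; move: (N^-1) => z /andP[z0 z1] h.
have h1 := sqr_ge0 (3 * z - kappa).
have h2 : z ^+ 2 <= z by rewrite expr2 ler_piMl.
have h3 : (3 * z + kappa) ^+ 2 = 2 * (9 * z ^+ 2 + kappa ^+ 2) - (3 * z - kappa) ^+ 2 by ring.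
rewrite h3 in h; move: h h1 h2 {h3}.
move: (z ^+ 2) ((3 * z - kappa) ^+ 2) (kappa ^+ 2) ((_ / _) ^+ 2) => a b c e; lra.
Qed.

End RowSums.

Lemma measurable_lambda1 (R : realType) d (T : measurableType d) n
    (A : T -> 'M[R]_n.+1) :
  (forall w, (A w)^T = A w) ->
  (forall i j, measurable_fun setT (fun w => A w i j)) ->
  measurable_fun setT (fun w => lambda1 (A w)).
Proof.
move=> sA mA mD; apply: (measurability _ (RGenOInfty.measurableE R)) => //.
move=> /= _ [_ [c ->] <-]; rewrite setTI preimage_itvoy.
pose y (r : 'rV[rat]_n.+1) : 'rV[R]_n.+1 := map_mx ratr r.
rewrite [X in measurable X](_ : _ = \bigcup_(r : 'rV[rat]_n.+1)
  [set w | c * dot (y r) (y r) < dot (y r *m A w) (y r)]).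
  apply: countable_bigcupT_measurable => // r.
  have mf : measurable_fun setT (fun w => dot (y r *m A w) (y r)).
    have -> : (fun w => dot (y r *m A w) (y r)) =
        (fun w => \sum_j (\sum_i y r 0 i * A w i j) * y r 0 j).
      by apply/funext => w; rewrite dotE; apply: eq_bigr => j _; rewrite mxE.
    apply: measurable_sum => j; apply: measurable_funM => //.
    by apply: measurable_sum => i; apply: measurable_funM => //.
  have := mf measurableT `]c * dot (y r) (y r), +oo[%classic (measurable_itv _).
  by rewrite setTI preimage_itvoy.
apply/seteqP; split=> [w /= /(lambda1_gtP _ (sA w))[r h]|w [r _ h] /=].
  by exists r.
by apply/(lambda1_gtP _ (sA w)); exists r.
Qed.

(** * The expansion for a matrix of fixed size *)

Section OneSize.
Context {R : realType} {d : measure_display} {T : measurableType d}.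
Variables (P : probability T R) (n : nat) (X : triu n.+1 -> {RV P >-> R}).
Variable (lam : R).
Hypothesis lam_gt0 : 0 < lam.

Local Notation N := (n.+1%:R : R).
Local Notation s := (Num.sqrt N).
Local Notation M w := (sym_mx (fun p => X p w) : 'M[R]_n.+1).

Definition spiked (w : T) : 'M[R]_n.+1 :=
  s^-1 *: (M w + (lam / s) *: ((const_mx 1 : 'cV[R]_n.+1) *m (const_mx 1 : 'cV[R]_n.+1)^T)).

(* [|b|^2 - 1] for [b] the component of [We] orthogonal to [e]. *)
Definition Uval (w : T) : R := meansq X w - totsum X w ^+ 2 / N ^+ 3 - 1.

(** What the expansion leaves over, by definition; the content lies in bounding it. *)
Definition Vval (w : T) : R :=
  s * (lambda1 (spiked w) - (lam + 1 / lam)) -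
  1 / N * (\sum_(i < n.+1) \sum_(j < n.+1) M w i j) - s / lam * Uval w.

Lemma sym_mx_tr w : (M w)^T = M w.
Proof. by apply/matrixP => i j; rewrite !mxE triu_pairC. Qed.

Let s_gt0 : 0 < s. Proof. by rewrite sqrtr_gt0. Qed.
Let s2 : s ^+ 2 = N. Proof. by rewrite sqr_sqrtr. Qed.
Let s_neq0 : s != 0. Proof. by rewrite gt_eqF. Qed.

Let e : 'rV[R]_n.+1 := s^-1 *: const_mx 1.

Lemma spikedE w : spiked w = s^-1 *: M w + lam *: (e^T *m e).
Proof.
rewrite /spiked scalerDr scalerA; congr (_ + _).
apply/matrixP => i j; rewrite !mxE !big_ord1 !mxE; field.
exact: s_neq0.
Qed.

Lemma spiked_sym w : (spiked w)^T = spiked w.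
Proof.
have sW : (s^-1 *: M w)^T = s^-1 *: M w by rewrite linearZ /= sym_mx_tr.
by rewrite spikedE; exact: rank_one_sym.
Qed.

Let dot_ee : dot e e = 1.
Proof.
rewrite dotE (eq_bigr (fun=> N^-1)) => [|i _].
  by rewrite sumr_const card_ord -[LHS]mulr_natl divff // pnatr_eq0.
by rewrite !mxE mulr1 -expr2 exprVn s2.
Qed.

Let e_mulmx w j : (e *m (s^-1 *: M w)) 0 j = linform X (rowsum j) w / N.
Proof.
rewrite mxE lin_rowsum mulr_suml; apply: eq_bigr => i _.
rewrite !mxE mulr1 mulrA -invfM -expr2 s2 mulrC //.
Qed.

Lemma dot_e_mulmx w : dot (e *m (s^-1 *: M w)) e = totsum X w / (N * s).
Proof.
rewrite dotE mulr_suml; apply: eq_bigr => j _.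
by rewrite e_mulmx !mxE mulr1 invfM mulrA.
Qed.

Lemma dot_e_mulmx2 w :
  dot (e *m (s^-1 *: M w)) (e *m (s^-1 *: M w)) = meansq X w.
Proof.
rewrite dotE /meansq mulr_suml; apply: eq_bigr => j _.
by rewrite !e_mulmx -expr2 expr_div_n.
Qed.

Lemma totsumE w : totsum X w = \sum_(i < n.+1) \sum_(j < n.+1) M w i j.
Proof.
rewrite exchange_big; apply: eq_bigr => j _; rewrite lin_rowsum.
by apply: eq_bigr => i _; rewrite mxE.
Qed.

(** A deterministic statement: by [mulmx_pow_norm] the trace bound forces the norm of [W] to be at
    most [K], and [lambda1_rank_one] does the rest. *)
Lemma Vval_bound k K w : 0 < K ->
  \tr (M w ^+ (2 ^ k.+1)) <= (K * s) ^+ (2 ^ k.+1) ->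
  `|Vval w| <= s * (36 * K ^+ 3 / lam ^+ 2).
Proof.
move=> K0 trM.
have Ks0 : 0 < K * s by exact: mulr_gt0.
have W_le x : dot (x *m (s^-1 *: M w)) (x *m (s^-1 *: M w)) <= K ^+ 2 * dot x x.
  have [->|x0] := eqVneq x 0; first by rewrite mul0mx !dot0l mulr0.
  rewrite -scalemxAr dotZl dotZr mulrA -expr2 exprVn s2 ler_pdivrMl //.
  have -> : N * (K ^+ 2 * dot x x) = (K * s) ^+ 2 * dot x x by rewrite exprMn s2; ring.
  rewrite -(ler_pXn2r (expn_gt0 2 k)) ?nnegrE ?dot_ge0 //; last first.
    by rewrite mulr_ge0 ?sqr_ge0 ?dot_ge0.
  apply: (le_trans (mulmx_pow_norm _ _ (sym_mx_tr w))).
  rewrite exprMn -exprM ler_wpM2r ?exprn_ge0 ?dot_ge0 //.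
  rewrite frobE; last by rewrite trmx_exp ?sym_mx_tr.
  by rewrite mulmxE -expr2 -exprM mulnC -expnS.
have sW : (s^-1 *: M w)^T = s^-1 *: M w by rewrite linearZ /= sym_mx_tr.
have := lambda1_rank_one sW dot_ee lam_gt0 K0 W_le.
rewrite -spikedE dot_e_mulmx dot_e_mulmx2 => h.
have -> : Vval w = s * (lambda1 (spiked w) - lam - 1 / lam - totsum X w / (N * s) -
    (meansq X w - (totsum X w / (N * s)) ^+ 2 - 1) / lam).
  rewrite /Vval -totsumE /Uval.
  have -> : (totsum X w / (N * s)) ^+ 2 = totsum X w ^+ 2 / N ^+ 3.
    by rewrite expr_div_n exprMn s2 -exprSr.
  move: (lambda1 _) (meansq _ _) (totsum _ _) => l q t; field.
  by apply/and3P; split; [rewrite gt_eqF|rewrite nat1r pnatr_eq0|exact: s_neq0].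
by rewrite normrM (gtr0_norm s_gt0) ler_pM2l.
Qed.

Lemma measurable_entry i j : measurable_fun setT (fun w => M w i j).
Proof.
have -> : (fun w => M w i j) = X (triu_pair i j) by apply/funext => w; rewrite mxE.
exact: measurable_funPT.
Qed.

Lemma measurable_Uval : measurable_fun setT Uval.
Proof.
apply: measurable_funB => //; apply: measurable_funB => //.
  exact: (expdom_meansq X).1.
apply: measurable_funM => //; apply: measurable_funX; exact: (expdom_totsum X).1.
Qed.

Lemma measurable_Vval : measurable_fun setT Vval.
Proof.
apply: measurable_funB; last by apply: measurable_funM => //; exact: measurable_Uval.
apply: measurable_funB.
  apply: measurable_funM => //; apply: measurable_funB => //.
  apply: measurable_lambda1 => [w|i j]; first exact: spiked_sym.
  have -> : (fun w => spiked w i j) = (fun w => s^-1 * M w i j + lam * (e^T *m e) i j).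
    by apply/funext => w; rewrite spikedE !mxE.
  apply: measurable_funD => //; apply: measurable_funM => //; exact: measurable_entry.
apply: measurable_funM => //; apply: measurable_sum => i; apply: measurable_sum => j.
exact: measurable_entry.
Qed.

End OneSize.

(** * Tails and tightness *)

Section Tails.
Context {R : realType} {d : measure_display} {T : measurableType d}.
Variable (P : probability T R).

Lemma measurable_gt (f : T -> R) (c : R) :
  measurable_fun setT f -> measurable [set w | (c < f w)%R].
Proof.
move=> mf; have := mf measurableT `]c, +oo[%classic (measurable_itv _).
by rewrite setTI preimage_itvoy.
Qed.

Lemma markov_mean (f : T -> R) (c : R) : 0 < c -> measurable_fun setT f -> (forall w, 0 <= f w) ->
  P.-integrable setT (EFin \o f) ->
  (P [set w | (c < f w)%R] <= (mean P f / c)%:E)%E.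
Proof.
move=> c0 mf f0 intf.
pose mf' := isMeasurableFun.Build _ _ _ _ _ mf.
pose F : {RV P >-> R} := HB.pack f mf'.
have h := @markov _ _ _ P F id c c0 (@measurable_id _ _ _) (fun r h => h) (fun x y _ _ h => h).
have eE : ('E_P[id \o (fun x => `|x|%R) \o F] = (mean P f)%:E)%E.
  rewrite unlock /mean /Rintegral fineK; last exact: integrable_fin_num.
  by apply: eq_integral => w _; rewrite /= ger0_norm.
rewrite eE in h.
have h2 : (P [set w | (c < f w)%R] <= P [set x | (c%:E <= `|(F x)%:E|)%E])%E.
  apply: le_measure; rewrite ?inE.
  - exact: measurable_gt.
  - have -> : [set x | (c%:E <= `|(F x)%:E|)%E] = f @^-1` `[c, +oo[%classic.
      by apply/seteqP; split=> w /=; rewrite lee_fin ger0_norm ?in_itv /= ?andbT.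
    by rewrite -[X in measurable X]setTI; exact: (mf measurableT _ (measurable_itv _)).
  - by move=> w /= cf; rewrite lee_fin ger0_norm // ltW.
apply: (le_trans h2); rewrite mulrC EFinM.
by rewrite lee_pdivlMl.
Qed.

Lemma tight_single (f : T -> R) (eta : R) : measurable_fun setT f -> 0 < eta ->
  exists M : R, (P [set w | (M < `|f w|)%R] <= eta%:E)%E.
Proof.
move=> mf eta0.
have mg : measurable_fun setT (fun w => `|f w|) by exact: measurableT_comp.
pose mg' := isMeasurableFun.Build _ _ _ _ _ mg.
pose G : {RV P >-> R} := HB.pack (fun w => `|f w|) mg'.
have h : \forall M \near +oo%R, (ccdf G M < eta%:E)%E.
  have := @cvg_ccdfy0 _ _ _ P G.
  move=> /(_ [set x | (x < eta%:E)%E]); apply.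
  by apply: open_nbhs_nbhs; split; [exact: open_ereal_lt_ereal|rewrite /= lte_fin].
have [M hM] := @filter_ex _ _ _ _ h.
exists M; rewrite ltW //; move: hM; rewrite /ccdf /distribution /pushforward.
by rewrite preimage_itvoy.
Qed.

End Tails.

(** Uniform tails are asked for large [n] only: the finitely many earlier variables are tight one by
    one, and their bounds are added into [B]. Restricting to [eta <= 1] loses nothing, smaller [eta]
    being harder. *)
Lemma tight_of_tail (R : realType) (d : nat -> measure_display)
    (T : forall n, measurableType (d n)) (P : forall n, probability (T n) R)
    (Z : forall n, T n -> R) :
  (forall n, measurable_fun setT (Z n)) ->
  (forall eta, 0 < eta -> eta <= 1 -> exists (M : R) (n0 : nat),
     forall n, (n0 <= n)%N -> (0 < n)%N ->
     (P n [set w | (M < `|Z n w|)%R] <= eta%:E)%E) ->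
  tight P Z.
Proof.
move=> mZ h eta' eta'0; pose eta := Num.min eta' 1.
have eta0 : 0 < eta by rewrite lt_min eta'0 ltr01.
have eta1 : eta <= 1 by rewrite ge_min lexx orbT.
have [M [n0 hM]] := h eta eta0 eta1.
have /choice[m hm] n := tight_single (P n) (mZ n) eta0.
pose B := `|M| + \sum_(i < n0) `|m i|.
have BM : M <= B by rewrite (le_trans (ler_norm _)) // lerDl sumr_ge0.
have Bm n : (n < n0)%N -> m n <= B.
  move=> nn0; rewrite (le_trans (ler_norm _)) // /B (bigD1 (Ordinal nn0)) //= addrCA lerDl.
  by rewrite addr_ge0 // sumr_ge0.
exists `[- B, B]%classic; split; first exact: segment_compact.
move=> n n_gt0.
have e : Z n @^-1` (~` `[- B, B]%classic) = [set w | B < `|Z n w|].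
  apply/seteqP; split=> w /=; rewrite in_itv /=.
    by move=> /negP; rewrite -ler_norml -ltNge.
  by move=> hB; apply/negP; rewrite -ler_norml -ltNge.
have mabs : measurable_fun setT (fun w => `|Z n w|) by exact: measurableT_comp.
rewrite e; apply: (@le_trans _ _ eta%:E); last by rewrite lee_fin ge_min lexx.
have [nn0|nn0] := ltnP n n0.
  apply: le_trans (hm n); apply: le_measure; rewrite ?inE; try exact: measurable_gt.
  by move=> w /=; apply: le_lt_trans; exact: Bm.
apply: le_trans (hM n nn0 n_gt0); apply: le_measure; rewrite ?inE; try exact: measurable_gt.
by move=> w /=; exact: le_lt_trans.
Qed.

(** The exponent [q = 2 ^ k.+1] has to satisfy two opposite demands: [2^q >= n], so that the factor
    [n] of the trace bound is harmless after taking a root, and [q] of order log n, so that [q^5]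
    loses against [n^delta]. Rounding log n up to a power of two does both. *)
Lemma log_pow_small (R : realType) (C delta : R) : 0 <= C -> 0 < delta ->
  exists n0 : nat, forall n, (n0 <= n)%N -> exists k : nat,
    (n <= 2 ^ (2 ^ k.+1))%N /\
    (2 ^ k.+1).+1%:R ^+ 5 * C * (n%:R `^ (- delta)) <= 1 :> R.
Proof.
move=> C0 delta0.
have ln2 : 0 < ln (2 : R) by rewrite ln_gt0 // ltr1n.
pose r := delta * ln (2 : R).
have r0 : 0 < r by rewrite mulr_gt0.
(* Threshold beyond which [C (8 u)^5] is below [(r u)^6 / 6!], a term of the series of
   [expR (r * u)]. Here [u = m - 1] because [m] is a rounded-up logarithm, so only [2^(m-1) < n] is
   available from below. *)
pose b := C * (8 ^ 5)%:R * 720 / r ^+ 6.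
have b0 : 0 <= b.
  apply: divr_ge0; last by apply: exprn_ge0; exact: ltW.
  by do 2 (apply: mulr_ge0; last exact: ler0n).
pose B := (Num.truncn b).+1.
have bB : b <= B%:R by rewrite ltW // truncnS_gt.
exists (2 ^ B.+2)%N => n hn.
pose m := up_log 2 n.
have n1 : (1 < n)%N by apply: leq_trans hn; rewrite (ltn_exp2l 0).
have /andP[hm1 hm2] := up_log_bounds (isT : (1 < 2)%N) n1; rewrite -/m in hm1 hm2.
have mB : (B.+2 <= m)%N by rewrite -(leq_exp2l _ _ (isT : (1 < 2)%N)) (leq_trans hn).
have m1 : (1 < m)%N by exact: leq_trans mB.
have /andP[hk1 hk2] := up_log_bounds (isT : (1 < 2)%N) m1.
have k0 : (0 < up_log 2 m)%N by rewrite lt0n; apply/eqP => e; rewrite e expn0 leqNgt m1 in hk2.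
exists (up_log 2 m).-1; rewrite prednK //; split.
  by apply: (leq_trans hm2); rewrite leq_exp2l.
set q := (2 ^ up_log 2 m)%N in hk2 *.
have qm : (q < 2 * m)%N by rewrite /q -(prednK k0) expnS ltn_pmul2l.
have q8 : (q.+1 <= 8 * m.-1)%N by clear -qm m1; lia.
pose u : R := m.-1%:R.
have u0 : 0 < u by rewrite ltr0n -subn1 subn_gt0.
have bu : b <= u by apply: (le_trans bB); rewrite ler_nat; clear -mB; lia.
have nR : (0 : R) < n%:R by rewrite ltr0n ltnW.
have hpow : expR (r * u) <= n%:R `^ delta.
  rewrite /powR gt_eqF // ler_expR /r -mulrA ler_pM2l //.
  rewrite mulr_natr -lnXn ?ler_ln ?posrE ?exprn_gt0 // -natrX ler_nat.
  by rewrite ltnW.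
rewrite powRN ler_pdivrMr ?powR_gt0 // mul1r; apply: le_trans hpow.
have h6 : (r * u) ^+ 6 / 720 <= expR (r * u).
  have := @expR_ge1Dxn R (r * u) 5 (mulr_ge0 (ltW r0) (ltW u0)).
  by rewrite (_ : 6`! = 720)%N //; apply: le_trans; rewrite lerDr.
apply: le_trans h6.
have h5 : q.+1%:R ^+ 5 <= (8 * u) ^+ 5 :> R.
  by rewrite lerXn2r ?nnegrE ?mulr_ge0 ?(ltW u0) // /u -natrM ler_nat.
apply: (le_trans (ler_wpM2r C0 h5)).
have -> : (8 * u) ^+ 5 * C = b * (r ^+ 6 * u ^+ 5 / 720).
  by rewrite /b natrX; field; rewrite gt_eqF.
have -> : (r * u) ^+ 6 / 720 = u * (r ^+ 6 * u ^+ 5 / 720) by field.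
apply: ler_wpM2r bu; apply: divr_ge0; last exact: ler0n.
by apply: mulr_ge0; apply: exprn_ge0; exact: ltW.
Qed.

(** * Tail bounds at a fixed size *)

Section SizeTails.
Context {R : realType} {d : measure_display} {T : measurableType d}.
Variables (P : probability T R) (n : nat) (X : triu n.+1 -> {RV P >-> R}) (rho : R).
Hypothesis X_gauss : gaussian_vector X.
Hypothesis X_centered : forall p, ('E_P[X p] = 0)%E.
Hypothesis X_sqr : forall p, mean P (fun w => X p w * X p w) = 1.
Hypothesis X_cov : forall p q, p != q -> `|mean P (fun w => X p w * X q w)| <= rho.
Hypothesis rho_ge0 : 0 <= rho.

Local Notation N := (n.+1%:R : R).
Local Notation s := (Num.sqrt N).
Local Notation M w := (sym_mx (fun p => X p w) : 'M[R]_n.+1).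

Hypothesis kappa_le1 : N * rho <= 1.

Lemma Vval_tail (lam : R) k (eta : R) : 0 < lam -> 0 < eta -> eta <= 1 ->
  (n.+1 <= 2 ^ (2 ^ k.+1))%N ->
  (2 ^ k.+1).+1%:R ^+ 5 * (2 + N * (N * rho)) <= 128 * N ->
  (P [set w | (36 * (32 / eta) ^+ 3 < `|Vval X lam w / (s / lam ^+ 2)|)%R] <= eta%:E)%E.
Proof.
move=> lam0 eta0 eta1 hk hN; set q := (2 ^ k.+1)%N in hk hN *.
have s0 : 0 < s by rewrite sqrtr_gt0.
(* With this [K], Markov's inequality bounds the probability by [n (16 / K)^q = n (eta / 2)^q]; as
   [n <= 2^q] and [eta <= 1], this is at most [eta]. *)
pose K := 32 / eta; have K0 : 0 < K by rewrite divr_gt0.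
have Ks : 0 < (K * s) ^+ q by rewrite exprn_gt0 // mulr_gt0.
have dtr : expdom X (fun w => \tr (M w ^+ q)).
  by apply: expdom_sum => u; exact: expdom_mxpow.
have trE w : \tr (M w ^+ q) = frob (M w ^+ (2 ^ k)).
  rewrite frobE; first by rewrite mulmxE -expr2 -exprM mulnC -expnS.
  by rewrite trmx_exp ?sym_mx_tr.
have h := markov_mean Ks dtr.1 (fun w => _) (expdom_integrable X_gauss dtr).
have {}h : (P [set w | ((K * s) ^+ q < \tr (M w ^+ q))%R] <= eta%:E)%E.
  apply: (le_trans (h _)) => [w|]; first by rewrite trE frob_ge0.
  rewrite lee_fin ler_pdivrMr //.
  apply: (le_trans (trace_moment_le X_gauss X_centered X_sqr X_cov rho_ge0 (leqnn q) kappa_le1 hN)).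
  rewrite [(16 * s) ^+ q]exprMn [(K * s) ^+ q]exprMn mulrA [leRHS]mulrA.
  rewrite ler_wpM2r ?exprn_ge0 ?(ltW s0) //.
  rewrite -ler_pdivrMr ?exprn_gt0 // -mulrA -expr_div_n.
  have -> : 16 / K = eta / 2 by rewrite /K; field; rewrite gt_eqF.
  rewrite expr_div_n mulrCA.
  have h1 : eta ^+ q <= eta.
    rewrite -[leRHS]expr1; apply: ler_wiXn2l; rewrite ?(ltW eta0) //.
    by rewrite expn_gt0.
  have h2 : N / 2 ^+ q <= 1 by rewrite ler_pdivrMr ?exprn_gt0 // mul1r -natrX ler_nat.
  by rewrite -[leRHS]mulr1; apply: ler_pM; rewrite ?exprn_ge0 ?divr_ge0 ?(ltW eta0).
have mV := measurable_Vval X lam.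
apply: le_trans h; apply: le_measure; rewrite ?inE.
- apply: measurable_gt; apply: measurableT_comp => //.
  by apply: measurable_funM.
- exact: measurable_gt dtr.1.
move=> w /=; apply: contraLR; rewrite -!leNgt => hw.
have := Vval_bound lam0 K0 hw.
have sl0 : 0 < s / lam ^+ 2 by rewrite divr_gt0 ?exprn_gt0.
rewrite normrM normfV (gtr0_norm sl0) ler_pdivrMr //.
move=> /le_trans; apply; rewrite -/K le_eqVlt; apply/orP; left; apply/eqP.
by rewrite mulrCA -!mulrA; congr (_ * _); rewrite mulrCA.
Qed.

(** From [(x - y)^2 <= 2 x^2 + 2 y^2], with [132 = 2 (12 + 54)] and [22 = 2 (5 + 6)]. Weakening
    [kappa^2] to [kappa] still gives the rate [n^(-min(eps,1)/2)] after a square root. *)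
Lemma mean_Uval2 : mean P (fun w => Uval X w ^+ 2) <= 132 / N + 22 * (N * rho).
Proof.
have hm := expdom_meansq X; have ht := expdom_totsum X.
have h1 : expdom X (fun w => (meansq X w - 1) ^+ 2).
  by apply: expdomX; apply: expdomB => //; exact: expdom_cst.
have h2 : expdom X (fun w => (totsum X w ^+ 2 / N ^+ 3) ^+ 2).
  by apply: expdomX; apply: expdomM; [exact: expdomX|exact: expdom_cst].
have hU : expdom X (fun w => Uval X w ^+ 2).
  apply: expdomX; apply: expdomB; last exact: expdom_cst.
  by apply: expdomB => //; apply: expdomM; [exact: expdomX|exact: expdom_cst].
apply: (@le_trans _ _ (mean P (fun w => 2 * (meansq X w - 1) ^+ 2 +
    2 * (totsum X w ^+ 2 / N ^+ 3) ^+ 2))).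
  apply: (mean_le X_gauss) => //; first by apply: expdomD; exact: expdomZ.
  move=> w; rewrite /Uval; move: (meansq X w) (_ / _) => x y.
  by have := sqr_ge0 (x - 1 + y); nra.
rewrite (meanD X_gauss); [|exact: expdomZ|exact: expdomZ].
rewrite !(meanZ X_gauss) //.
have e1 := mean_meansq_sqr X_gauss X_centered X_sqr X_cov rho_ge0 kappa_le1.
have e2 := mean_totsum4 X_gauss X_centered X_sqr X_cov rho_ge0 kappa_le1.
have k0 : 0 <= N * rho by rewrite mulr_ge0.
have k2 : (N * rho) ^+ 2 <= N * rho by rewrite expr2 ler_piMl.
move: e1 e2 k2; move: (mean _ _) (mean _ _) ((N * rho) ^+ 2) (N * rho) (N^-1) => a b c e z.
lra.
Qed.

Lemma Uval_tail (tau B : R) : 0 < tau -> 0 < B ->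
  (P [set w | (B < `|Uval X w / tau|)%R] <=
   ((132 / N + 22 * (N * rho)) / (B * tau) ^+ 2)%:E)%E.
Proof.
move=> tau0 B0.
have Bt : 0 < (B * tau) ^+ 2 by rewrite exprn_gt0 // mulr_gt0.
have hU : expdom X (fun w => Uval X w ^+ 2).
  apply: expdomX; apply: expdomB; last exact: expdom_cst.
  apply: expdomB; first exact: expdom_meansq.
  apply: expdomM; last exact: expdom_cst.
  by apply: expdomX; exact: expdom_totsum.
have h := markov_mean Bt hU.1 (fun w => sqr_ge0 _) (expdom_integrable X_gauss hU).
apply: (@le_trans _ _ (P [set w | ((B * tau) ^+ 2 < Uval X w ^+ 2)%R])).
  apply: le_measure; rewrite ?inE.
  - apply: measurable_gt; apply: measurableT_comp => //.
    by apply: measurable_funM => //; exact: measurable_Uval.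
  - exact: measurable_gt hU.1.
  move=> w /=; rewrite normrM normfV (gtr0_norm tau0) ltr_pdivlMr // => hw.
  rewrite -[X in _ < X]real_normK ?num_real //; apply: ltrXn2r => //.
  by rewrite mulr_ge0 // ltW.
apply: (le_trans h); rewrite lee_fin ler_pM2r ?invr_gt0 //; exact: mean_Uval2.
Qed.

End SizeTails.

(** Random variables must be supplied at [n = 0] too, where there is only one matrix. *)
Lemma measurable_fun_mx0 (R : realType) (d : measure_display) (T : measurableType d)
    (f : 'M[R]_0 -> R) (A : T -> 'M[R]_0) : measurable_fun setT (fun w => f (A w)).
Proof.
have -> : (fun w => f (A w)) = fun=> f 0 by apply/funext => w; rewrite [A w]flatmx0.
exact: measurable_cst.
Qed.

Definition Uvar (R : realType) (d : measure_display) (T : measurableType d)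
    (P : probability T R) (n : nat) : (triu n -> {RV P >-> R}) -> T -> R :=
  if n is n'.+1 then fun X => Uval X else fun _ _ => 0.

Section Remainder.
Context {R : realType} {d : measure_display} {T : measurableType d}.
Variables (P : probability T R) (n : nat) (X : triu n -> {RV P >-> R}) (lam : R).

Definition Vvar (w : T) : R :=
  let s := Num.sqrt (n%:R : R) in
  let M := sym_mx (fun p => X p w) : 'M[R]_n in
  s * (lambda1 (s^-1 *: (M + (lam / s) *:
        ((const_mx 1 : 'cV[R]_n) *m (const_mx 1 : 'cV[R]_n)^T))) - (lam + 1 / lam)) -
  1 / n%:R * (\sum_(i < n) \sum_(j < n) M i j) - s / lam * Uvar X w.

Lemma measurable_Uvar : measurable_fun setT (Uvar X).
Proof. by case: n X => [|n'] Y //=; exact: measurable_Uval. Qed.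

Lemma measurable_Vvar : measurable_fun setT Vvar.
Proof.
rewrite /Vvar; case: n X => [|n'] Y; last exact: measurable_Vval.
apply: measurable_funB; last by apply: measurable_funM => //; exact: measurable_cst.
apply: measurable_funB.
  apply: measurable_funM => //; apply: measurable_funB => //.
  exact: (measurable_fun_mx0 (@lambda1 R 0)).
by apply: measurable_funM => //; apply: measurable_sum => -[].
Qed.

Variable rho : R.
Hypothesis n_gt0 : (0 < n)%N.
Hypothesis X_gauss : gaussian_vector X.
Hypothesis X_centered : forall p, ('E_P[X p] = 0)%E.
Hypothesis X_sqr : forall p, mean P (fun w => X p w * X p w) = 1.
Hypothesis X_cov : forall p q, p != q -> `|mean P (fun w => X p w * X q w)| <= rho.
Hypothesis rho_ge0 : 0 <= rho.
Hypothesis kappa_le1 : n%:R * rho <= 1.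

Lemma Vvar_tail k (eta : R) : 0 < lam -> 0 < eta -> eta <= 1 ->
  (n <= 2 ^ (2 ^ k.+1))%N ->
  (2 ^ k.+1).+1%:R ^+ 5 * (2 + n%:R * (n%:R * rho)) <= 128 * n%:R ->
  (P [set w | (36 * (32 / eta) ^+ 3 <
     `|Vvar w / (Num.sqrt n%:R / lam ^+ 2)|)%R] <= eta%:E)%E.
Proof.
rewrite /Vvar; case: n n_gt0 X X_gauss X_centered X_sqr X_cov kappa_le1 =>
  // n' _ Y Yg Yc Ys Yv k1.
exact: Vval_tail.
Qed.

Lemma Uvar_tail (tau B : R) : 0 < tau -> 0 < B ->
  (P [set w | (B < `|Uvar X w / tau|)%R] <=
   ((132 / n%:R + 22 * (n%:R * rho)) / (B * tau) ^+ 2)%:E)%E.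
Proof.
case: n n_gt0 X X_gauss X_centered X_sqr X_cov kappa_le1 => // n' _ Y Yg Yc Ys Yv k1.
exact: Uval_tail.
Qed.

End Remainder.

(** * From the covariance hypotheses to the theorem *)

Lemma mean_sqr_of_variance (R : realType) (d : measure_display) (T : measurableType d)
    (P : probability T R) (X : {RV P >-> R}) :
  ('E_P[X] = 0)%E -> ('V_P[X] = 1)%E -> mean P (fun w => X w * X w) = 1.
Proof.
move=> X0; rewrite /variance covariance.unlock X0 unlock => h.
rewrite /mean /Rintegral -[RHS]/(fine 1%E) -h; congr fine.
apply: eq_integral => w _ /=; congr (_%:E).
by rewrite -[RHS]/((X w - 0) * (X w - 0)) subr0.
Qed.

Lemma mean_cov_le_sup (R : realType) (d : measure_display) (T : measurableType d)
    (P : probability T R) (I : finType) (X : I -> {RV P >-> R}) p q :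
  p != q -> `|mean P (fun w => X p w * X q w)| <=
  sup [set c : R | exists p q, p != q /\
    c = `| fine ('E_P[fun w => (X p w * X q w)%R])%E |].
Proof.
move=> pq.
have e p' q' : fine ('E_P[fun w => (X p' w * X q' w)%R])%E = mean P (fun w => X p' w * X q' w).
  by rewrite unlock.
apply: sup_upper_bound; last by exists p, q; rewrite e.
split; first by exists `|mean P (fun w => X p w * X q w)|; exists p, q; rewrite e.
(* An upper bound must be exhibited, as [sup] of an unbounded set is a default value; the finite sum
   over all pairs is one. *)
exists (\sum_p' \sum_q' `|mean P (fun w => X p' w * X q' w)|) => _ [p' [q' [_ ->]]].
rewrite e (bigD1 p') //= (bigD1 q') //= -addrA lerDl.
by rewrite addr_ge0 // sumr_ge0 // => ? _; rewrite sumr_ge0.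
Qed.

Theorem theorem2 (R : realType) (eps D : R) (eps_gt0 : 0 < eps) (D_gt0 : 0 < D)
    (d : nat -> measure_display) (T : forall n, measurableType (d n))
    (P : forall n, probability (T n) R)
    (X : forall n, triu n -> {RV (P n) >-> R})
    (X_gaussian : forall n, (0 < n)%N -> gaussian_vector (X n))
    (X_centered : forall n (p : triu n), ('E_(P n)[X n p] = 0)%E)
    (X_var1 : forall n (p : triu n), ('V_(P n)[X n p] = 1)%E)
    (X_cov :
      (fun n : nat => sup [set c : R | exists p q : triu n,
         p != q /\ c = `| fine ('E_(P n)[fun w => (X n p w * X n q w)%R])%E |])
      =O_\oo (fun n : nat => 1 / (n%:R : R) `^ (1 + eps)))
    (lam : nat -> R)
    (lam_bound : forall n, (0 < n)%N ->
      0 < lam n /\ lam n <= D * Num.sqrt n%:R) :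
  let Xmx n (w : T n) : 'M[R]_n := sym_mx (fun p => X n p w) in
  let mu n : R := lam n / Num.sqrt n%:R in
  let Y n (w : T n) : 'M[R]_n :=
    Xmx n w + mu n *: ((const_mx 1 : 'cV[R]_n) *m (const_mx 1 : 'cV[R]_n)^T) in
  exists U V : forall n, {RV (P n) >-> R},
    [/\ is_OP U (fun n => n%:R `^ (- (Num.min eps 1 / 2))),
        is_OP V (fun n => Num.sqrt n%:R / lam n ^+ 2) &
        forall n (w : T n), (0 < n)%N ->
          Num.sqrt n%:R *
            (lambda1 ((Num.sqrt n%:R)^-1 *: Y n w) - (lam n + 1 / lam n))
          = 1 / n%:R * (\sum_(i < n) \sum_(j < n) Xmx n w i j)
            + Num.sqrt n%:R / lam n * U n w + V n w].
Proof.
move=> Xmx mu Y.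
pose mU n := isMeasurableFun.Build _ _ _ _ _ (measurable_Uvar (X n)).
pose mV n := isMeasurableFun.Build _ _ _ _ _ (measurable_Vvar (X n) (lam n)).
pose U n : {RV (P n) >-> R} := HB.pack (Uvar (X n)) (mU n).
pose V n : {RV (P n) >-> R} := HB.pack (Vvar (X n) (lam n)) (mV n).
(* [tau n] is the square of the rate claimed for [U]; it dominates both [1 / n] and, up to [C],
   [n rho]. *)
pose delta := Num.min eps 1; pose tau n : R := n%:R `^ (- delta).
have delta0 : 0 < delta by rewrite lt_min eps_gt0 ltr01.
pose rho n := `|sup [set c : R | exists p q : triu n,
  p != q /\ c = `| fine ('E_(P n)[fun w => (X n p w * X n q w)%R])%E |]|.
have cov_rho n p q : p != q -> `|mean (P n) (fun w => X n p w * X n q w)| <= rho n.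
  by move=> pq; apply: le_trans (mean_cov_le_sup (X n) pq) (ler_norm _).
have [C C0 [n1 _ hC]] := (eqO_exP _ _ _).1 X_cov.
have tau_gt0 n : (0 < n)%N -> 0 < tau n by move=> n0; rewrite powR_gt0 // ltr0n.
have n_rho n : (0 < n)%N -> (n1 <= n)%N -> n%:R * rho n <= C * tau n.
  move=> n0 nn1; have nR : (0 : R) < n%:R by rewrite ltr0n.
  have := hC n nn1; rewrite /= -/(rho n) => h.
  apply: (le_trans (ler_wpM2l (ler0n _ n) h)); rewrite mulrCA ler_pM2l //.
  rewrite ger0_norm; last by rewrite divr_ge0 // powR_ge0.
  rewrite mul1r powRD; last by apply/implyP => _; rewrite gt_eqF.
  rewrite powRr1 ?ler0n // invfM mulrA divff ?gt_eqF // mul1r -powRN.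
  by rewrite ler_powR ?ler1n // lerN2 ge_min lexx.
have n_inv n : (0 < n)%N -> n%:R^-1 <= tau n.
  move=> n0; rewrite -powR_inv1 ?ler0n // ler_powR ?ler1n // lerN2 ge_min lexx.
  by rewrite orbT.
(* The constant [C + 2] appears because [2 + n (n rho)] is at most [n (2 + C) tau n]. The one
   resulting inequality yields both conditions on [n] below. *)
have [n2 hn2] := log_pow_small (addr_ge0 (ltW C0) (ler0n R 2)) delta0.
have large n : (0 < n)%N -> (n1 <= n)%N -> (n2 <= n)%N ->
  n%:R * rho n <= 1 /\ exists k, (n <= 2 ^ (2 ^ k.+1))%N /\
    (2 ^ k.+1).+1%:R ^+ 5 * (2 + n%:R * (n%:R * rho n)) <= 128 * n%:R.
  move=> n0 nn1 nn2; have [k [hk1 hk2]] := hn2 n nn2.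
  have t0 := tau_gt0 n n0; have nR : (0 : R) < n%:R by rewrite ltr0n.
  set L := (2 ^ k.+1).+1%:R ^+ 5 in hk2 *.
  have L1 : 1 <= L by rewrite exprn_ege1 // ler1n.
  have L0 : 0 <= L by exact: le_trans L1.
  have hr := n_rho n n0 nn1; rewrite -/(tau n) -mulrA in hk2.
  split.
    apply: (le_trans hr); apply: le_trans hk2.
    apply: (@le_trans _ _ ((C + 2) * tau n)); first by rewrite ler_pM2r // lerDl.
    by rewrite ler_peMl // mulr_ge0 ?(ltW t0) // addr_ge0 // ltW.
  exists k; split=> //; rewrite -/L.
  apply: (@le_trans _ _ (n%:R * (L * ((C + 2) * tau n)))).
    rewrite [leRHS]mulrCA ler_wpM2l // mulrDl mulrDr [leRHS]addrC lerD //; last first.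
      by rewrite ler_wpM2l.
    have := n_inv n n0; rewrite -(ler_pM2l nR) mulfV ?gt_eqF // mulrCA => h.
    by rewrite -[leLHS]mulr1 ler_wpM2l.
  rewrite mulrC ler_wpM2r //; apply: (le_trans hk2); exact: ler1n.
have sqr_tau n : (n%:R `^ (- (delta / 2))) ^+ 2 = tau n.
  rewrite -powR_mulrn ?powR_ge0 // -powRrM; congr (_ `^ _).
  by rewrite mulNr divfK ?pnatr_eq0.
have Xsqr n p : mean (P n) (fun w => X n p w * X n p w) = 1 by exact: mean_sqr_of_variance.
have mdiv n (f : T n -> R) c : measurable_fun setT f -> measurable_fun setT (fun w => f w / c).
  by move=> mf; apply: measurable_funM => //.
exists U, V; split.
- apply: tight_of_tail => [n|eta eta0 eta1]; first exact: mdiv (measurable_Uvar _).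
  pose C2 := 132 + 22 * C.
  have C20 : 0 < C2 by rewrite /C2; lra.
  (* The tail is at most [C2 / B^2], and [B >= 1] together with [B >= C2 / eta] brings this below
     [eta]. *)
  pose B := C2 / eta + 1.
  have Beta : C2 / eta <= B by rewrite lerDl.
  have B1 : 1 <= B by rewrite lerDr divr_ge0 // ltW.
  exists B, (n1 + n2)%N => n nn n0.
  have [k1 _] := large n n0 (leq_trans (leq_addr _ _) nn) (leq_trans (leq_addl _ _) nn).
  have hr := n_rho n n0 (leq_trans (leq_addr _ _) nn).
  have hi := n_inv n n0; have ht := sqr_tau n.
  have t'0 : 0 < n%:R `^ (- (delta / 2)) :> R by rewrite powR_gt0 // ltr0n.
  have t0 := tau_gt0 n n0.
  apply: (le_trans (Uvar_tail n0 (X_gaussian n n0) (X_centered n) (Xsqr n) (cov_rho n)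
    (normr_ge0 _) k1 t'0 (lt_le_trans ltr01 B1))).
  rewrite lee_fin exprMn ht ler_pdivrMr; last first.
    by rewrite mulr_gt0 ?exprn_gt0 // (lt_le_trans ltr01 B1).
  apply: (@le_trans _ _ (C2 * tau n)).
    have -> : C2 * tau n = 132 * tau n + 22 * (C * tau n) by rewrite /C2; ring.
    by apply: lerD; apply: ler_wpM2l => //; exact: ler0n.
  rewrite mulrA ler_wpM2r ?(ltW t0) //.
  apply: (@le_trans _ _ (eta * B)); first by rewrite -ler_pdivrMl // mulrC.
  by rewrite ler_wpM2l ?(ltW eta0) // expr2 ler_peMl // (le_trans ler01).
- apply: tight_of_tail => [n|eta eta0 eta1]; first exact: mdiv (measurable_Vvar _ _).
  exists (36 * (32 / eta) ^+ 3), (n1 + n2)%N => n nn n0.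
  have [k1 [k [hk hN]]] := large n n0 (leq_trans (leq_addr _ _) nn) (leq_trans (leq_addl _ _) nn).
  exact: (Vvar_tail n0 (X_gaussian n n0) (X_centered n) (Xsqr n) (cov_rho n)
    (normr_ge0 _) k1 (lam_bound n n0).1 eta0 eta1 hk hN).
(* The identity holds pointwise since [V] is the difference of the other terms. *)
move=> n w n0; rewrite /V /U /= /Vvar /Y /mu /Xmx.
by rewrite -[X in _ = _ + X]addrA -opprD [RHS]addrC subrK.
Qed.
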